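(* Consider the multi-antenna OFDM system described in the context, where every subcarrier $l\in\{0,\dots,N_{\rm sc}-1\}$ uses the conventional frequency-selective maximum-ratio-transmission precoder $\mathbf{w}_l=\hat{\mathbf{h}}_l^{*}/\|\hat{\mathbf{h}}_l\|$. Then the transmission for the full OFDM block, $-N_{\rm cp}\le k\le N_{\rm fft}-1$, is tending to a time-varying single-antenna two-tap channel: as $N_{\rm t}\to\infty$, $$\frac{r[k]}{\sqrt{N_{\rm t}}}\;\to\;\frac{\beta_k^2}{\alpha_L}\,s[k]+\frac{\alpha_L^2-\beta_k^2}{\alpha_L}\,s[k-N_{\rm fft}],\qquad \beta_k^2=\sum_{m=0}^{\min(k+N_{\rm cp},\,L-1)}E_m ;$$ and this further reduces to a single-tap flat channel only for the indices $L-N_{\rm cp}\le k\le N_{\rm fft}-1$: $$\frac{r[k]}{\sqrt{N_{\rm t}}}\;\to\;\alpha_L\, s[k].$$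
   Context: **Parameters.** $N_{\rm fft}$ (FFT size), $N_{\rm sc}\le N_{\rm fft}$ (number of occupied subcarriers), $N_{\rm cp}\ge0$ (cyclic prefix length), $L\ge1$ (number of channel taps, with $L\le N_{\rm fft}$) and $N_{\rm t}$ (number of transmit antennas) are integers; $\mathrm{j}=\sqrt{-1}$. Superscripts $*$, $\mathrm T$, $\dagger$ denote complex conjugate, transpose and conjugate transpose. All parameters other than $N_{\rm t}$ are fixed as $N_{\rm t}\to\infty$. **Channel.** For $p=0,\dots,L-1$ the tap vector $\mathbf{h}_p=\mathbf{h}[p]\in\mathbb{C}^{N_{\rm t}}$ has i.i.d. zero-mean complex normal entries of variance $E_p$, and the taps $\mathbf{h}_0,\dots,\mathbf{h}_{L-1}$ are independent. Put $\alpha_L^2=\sum_{p=0}^{L-1}E_p$ with $\alpha_L>0$. The frequency response on subcarrier $i$ is $\hat{\mathbf{h}}_i=\sum_{p=0}^{L-1}\mathbf{h}_p e^{-\mathrm{j}2\pi ip/N_{\rm fft}}$. Limits as $N_{\rm t}\to\infty$ are those following from the law of large numbers, $\mathbf{h}_p^{\dagger}\mathbf{h}_q/N_{\rm t}\to E_p\delta_{p,q}$. **Transmitted signals.** The data symbols $x_{b,l}\in\mathbb{C}$ ($b\in\mathbb{Z}$ the block index, $0\le l\le N_{\rm sc}-1$ the subcarrier index) are i.i.d. zero-mean complex normal with average power $P$. For each block $b$, for $-N_{\rm cp}\le k\le N_{\rm fft}-1$, $$\mathbf{s}_b[k]=\frac{1}{\sqrt{N_{\rm sc}}}\sum_{l=0}^{N_{\rm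 sc}-1}\mathbf{w}_l x_{b,l}e^{\mathrm{j}2\pi lk/N_{\rm fft}},\qquad s_b[k]=\frac{1}{\sqrt{N_{\rm sc}}}\sum_{l=0}^{N_{\rm sc}-1}x_{b,l}e^{\mathrm{j}2\pi lk/N_{\rm fft}},$$ and $\mathbf{s}_b[k]=\mathbf 0$, $s_b[k]=0$ for other $k$. Here $\mathbf{w}_l\in\mathbb{C}^{N_{\rm t}}$ is the precoder of subcarrier $l$. The multi-antenna and single-antenna OFDM signals are $$\mathbf{s}[k]=\sum_b\mathbf{s}_b[k-b(N_{\rm cp}+N_{\rm fft})],\qquad s[k]=\sum_b s_b[k-b(N_{\rm cp}+N_{\rm fft})].$$ **Received signal.** $r[k]=\sum_{m=0}^{L-1}\mathbf{h}^{\mathrm T}[m]\,\mathbf{s}[k-m]+z[k]$, where $z[k]$ is zero-mean complex additive white Gaussian noise of variance $\sigma_z^2$.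
   Formalization: The ''only for the indices'' claim is proved assuming P>0 and β_k²≠α_L²: as stated it fails at k=L−1−N_cp (where β_k²=α_L², so the limit is already flat), where the remaining taps have zero energy, and when P=0. *)

(* Defs.v *)
From HB Require Import structures.
From mathcomp Require Export all_boot all_order all_algebra.
From mathcomp Require Export complex.
From mathcomp Require Export all_classical all_reals all_analysis.

Set Implicit Arguments.
Unset Strict Implicit.
Unset Printing Implicit Defensive.

Export Order.TTheory GRing.Theory Num.Theory.
Export numFieldNormedType.Exports.

Local Open Scope classical_set_scope.
Local Open Scope ring_scope.
Local Open Scope complex_scope.

Section Probability.
Context {R : realType} {d : measure_display} {Omega : measurableType d}.
Variable P : probability Omega R.

(* [normal_prob m s] takes the standard deviation [s] and is a normal law only
   for [s != 0]; the normal law of variance 0 is the point mass at the mean. *)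
Definition centered_normal (v : R) (A : set R) : \bar R :=
  if v == 0 then \d_(0 : measurableTypeR R) A else normal_prob 0 (Num.sqrt v) A.

Definition complex_pair (c : R[i]) : R * R := (complex.Re c, complex.Im c).

(* Circularly symmetric CN(0, v): the real and imaginary parts are independent,
   each of variance v / 2, so that E |Z|^2 = v. *)
Definition complex_normal (v : R) (Z : Omega -> R[i]) : Prop :=
  measurable_fun [set: Omega] (complex_pair \o Z) /\
  forall A B : set R, measurable A -> measurable B ->
    P ((complex_pair \o Z) @^-1` (A `*` B)) =
    (centered_normal (v / 2) A * centered_normal (v / 2) B)%E.

(* C carries no sigma-algebra in the library: its Borel sets are those of R^2. *)
Definition mutually_independent {I : choiceType} (Z : I -> Omega -> R[i]) :
    Prop :=
  forall (J : seq I) (A : I -> set (R * R)),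
    uniq J -> (forall i, measurable (A i)) ->
    P (\bigcap_(i in [set` J]) (complex_pair \o Z i) @^-1` A i) =
    (\prod_(i <- J) P ((complex_pair \o Z i) @^-1` A i))%E.

Definition iid_complex_normal {I : choiceType} (v : R) (Z : I -> Omega -> R[i]) :
    Prop :=
  (forall i, complex_normal v (Z i)) /\ mutually_independent Z.

End Probability.

Section MultiAntennaOFDM.
Context {R : realType}.
Variables (Nfft Nsc Ncp L : nat).

(* e^{j 2 pi m / Nfft} *)
Definition twiddle (m : int) : R[i] :=
  let t := 2 * pi * m%:~R / Nfft%:R in cos t +i* sin t.

Definition in_block (k : int) : bool := (- Ncp%:Z <= k <= Nfft%:Z - 1)%R.

(* Euclidean norm; the library norm on matrices is the max norm. *)
Definition l2norm (n : nat) (v : 'cV[R[i]]_n) : R[i] :=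
  sqrtC (\sum_a `|v a 0| ^+ 2).

Definition ofdm_block_vec (Nt : nat) (w : 'I_Nsc -> 'cV[R[i]]_Nt)
    (x : int -> 'I_Nsc -> R[i]) (b k : int) : 'cV[R[i]]_Nt :=
  if in_block k then
    (sqrtC Nsc%:R)^-1 *: \sum_(l < Nsc) (x b l * twiddle (l%:Z * k)) *: w l
  else 0.

Definition ofdm_block (x : int -> 'I_Nsc -> R[i]) (b k : int) : R[i] :=
  if in_block k then
    (sqrtC Nsc%:R)^-1 * \sum_(l < Nsc) x b l * twiddle (l%:Z * k)
  else 0.

(* The sums over all b in Z are finitely supported: the blocks occupy pairwise
   disjoint intervals of length Ncp + Nfft > 0. *)
Definition ofdm_vec (Nt : nat) (w : 'I_Nsc -> 'cV[R[i]]_Nt)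
    (x : int -> 'I_Nsc -> R[i]) (k : int) : 'cV[R[i]]_Nt :=
  \sum_(b \in [set: int]) ofdm_block_vec w x b (k - b * (Ncp + Nfft)%N%:Z).

Definition ofdm (x : int -> 'I_Nsc -> R[i]) (k : int) : R[i] :=
  \sum_(b \in [set: int]) ofdm_block x b (k - b * (Ncp + Nfft)%N%:Z).

(* [h p a] is the gain of tap p at antenna a; with Nt antennas the taps are the
   vectors of the first Nt gains. *)
Definition tap_vec (h : 'I_L -> nat -> R[i]) (Nt : nat) (p : 'I_L) :
    'cV[R[i]]_Nt := \col_(a < Nt) h p a.

Definition freq_response (h : 'I_L -> nat -> R[i]) (Nt : nat) (i : nat) :
    'cV[R[i]]_Nt :=
  \sum_(p < L) twiddle (- (i%:Z * p%:Z)) *: tap_vec h Nt p.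

Definition mrt_precoder (h : 'I_L -> nat -> R[i]) (Nt : nat) (l : 'I_Nsc) :
    'cV[R[i]]_Nt :=
  (l2norm (freq_response h Nt l))^-1 *:
  map_mx (@Num.conj R[i]) (freq_response h Nt l).

Definition received (h : 'I_L -> nat -> R[i]) (x : int -> 'I_Nsc -> R[i])
    (z : int -> R[i]) (Nt : nat) (w : 'I_Nsc -> 'cV[R[i]]_Nt) (k : int) : R[i] :=
  \sum_(m < L) ((tap_vec h Nt m)^T *m ofdm_vec w x (k - m%:Z)) 0 0 + z k.

Definition alphaL (E : 'I_L -> R) : R := Num.sqrt (\sum_(p < L) E p).

(* The squared coefficient beta_k^2, not beta_k. *)
Definition beta2 (E : 'I_L -> R) (k : int) : R :=
  \sum_(m < L | m%:Z <= Num.min (k + Ncp%:Z) (L%:Z - 1)) E m.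

End MultiAntennaOFDM.

(* Main.v *)
From HB Require Import structures.
Require Import Defs.
From mathcomp Require Import measurable_realfun lra ring zify.

(* Write r[k] through the sample correlations of the taps: after division by
   sqrt Nt the received signal is a fixed algebraic expression in
   h_p^dagger h_q / Nt, which converge almost surely to E_p delta_pq.
   Tap m then contributes E_m / alpha_L times the symbol it sees, and the
   precoder's phase e^{j 2 pi l m / Nfft} undoes the delay, so every tap sees
   sample k itself, either of the current block (m <= k + Ncp) or, cyclically
   shifted, of the previous one.  Conversely, were the limit flat at an index
   with beta_k^2 <> alpha_L^2, two consecutive blocks would almost surely carry
   the same sample, which independence of the symbols forbids.

   The strong law used here only needs uncorrelated summands with bounded second
   moments: sum_n E(S_{n^2}^2) / n^4 and sum_n E(fluctuation of S between n^2 and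
   (n+1)^2)^2 / n^4 are both finite. *)

Set Implicit Arguments.
Unset Strict Implicit.
Unset Printing Implicit Defensive.

Local Open Scope classical_set_scope.
Local Open Scope ring_scope.
Local Open Scope complex_scope.

(** * Strong law of large numbers *)

(** Randomness enters at two points only: the almost sure correlations of the taps, and the converse
    for indices where the channel is not flat. In between, everything is limit algebra for one fixed
    outcome; a single null set serves all pairs of taps because there are finitely many, and the
    noise sample is then a constant divided by a growing square root. Of the normal law, the
    correlations use the mean, the variance and a finite fourth moment. Order four is forced: the
    summands of the strong law are already products of two gains, so their second moments are of
    order four. The converse uses instead that a nondegenerate normal law charges every open
    interval. The obstacle lies in the correlation of two different taps. Decorrelating the products
    at antennas [m] and [n] involves four distinct gains, so pairwise independence does not suffice:
    independence on rectangles must be lifted to the joint law of three gains against the fourth.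
    Complex limits are taken on real and imaginary parts, each of variance [v / 2]; the two halves
    add up to [E p]. *)

Section Slln.
Context {R : realType} {d : measure_display} {T : measurableType d}.
Variable P : probability T R.

Lemma Rintegral_sum (I : Type) (s : seq I) (f : I -> T -> R) :
  (forall i, P.-integrable setT (EFin \o f i)) ->
  (\int[P]_w (\sum_(i <- s) f i w) = \sum_(i <- s) \int[P]_w f i w) /\
  P.-integrable setT (EFin \o (fun w => \sum_(i <- s) f i w)).
Proof.
move=> fi; elim: s => [|i s [IH1 IH2]].
  under [in X in X /\ _]eq_Rintegral do rewrite big_nil.
  rewrite big_nil Rintegral_cst// mul0r; split=> //.
  apply: (eq_integrable _ (cst 0%E)) => //; last exact: integrable0.
  by move=> w _ /=; rewrite big_nil.
split.
  under eq_Rintegral do rewrite big_cons.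
  by rewrite RintegralD// big_cons IH1.
apply: (eq_integrable _ (fun w => (f i w)%:E + (\sum_(j <- s) f j w)%:E)%E) => //.
  by move=> w _ /=; rewrite big_cons EFinD.
exact: (integrableD measurableT (fi i) IH2).
Qed.

(** Expanding the square, the off-diagonal terms integrate to 0 and [size s] diagonal terms remain.
    An arbitrary duplicate-free list covers both the partial sums up to a square and the
    fluctuations after it. *)
Lemma second_moment_sum (Y : nat -> T -> R) (C : R) (s : seq nat) :
  (forall m n, P.-integrable setT (EFin \o (fun w => Y m w * Y n w))) ->
  (forall n, \int[P]_w (Y n w * Y n w) <= C) ->
  (forall m n, m != n -> \int[P]_w (Y m w * Y n w) = 0) ->
  uniq s ->
  P.-integrable setT (EFin \o (fun w => (\sum_(a <- s) Y a w) ^+ 2)) /\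
  \int[P]_w ((\sum_(a <- s) Y a w) ^+ 2) <= C * (size s)%:R.
Proof.
move=> iY Y2 Y0 us.
have E w : (\sum_(a <- s) Y a w) ^+ 2 = \sum_(a <- s) \sum_(b <- s) Y a w * Y b w.
  by rewrite expr2 big_distrlr.
have [_ H2] := @Rintegral_sum _ s (fun a w => \sum_(b <- s) Y a w * Y b w)
  (fun a => (@Rintegral_sum _ s (fun b w => Y a w * Y b w) (iY a)).2).
split.
  by apply: eq_integrable H2 => // w _ /=; rewrite E.
under eq_Rintegral do rewrite E.
rewrite (@Rintegral_sum _ s (fun a w => \sum_(b <- s) Y a w * Y b w)
  (fun a => (@Rintegral_sum _ s (fun b w => Y a w * Y b w) (iY a)).2)).1.
rewrite -sum1_size natr_sum mulr_sumr big_seq [leRHS]big_seq.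
apply: ler_sum => a sa; rewrite mulr1.
rewrite (@Rintegral_sum _ s (fun b w => Y a w * Y b w) (iY a)).1.
rewrite (bigD1_seq a)//= big1 ?addr0// => b ba.
by apply: Y0; rewrite eq_sym.
Qed.

(** By monotone convergence the series of the [f n] has integral at most [K], so it is finite almost
    everywhere, and the terms of a convergent series tend to 0. *)
Lemma ae_cvg0_sum (f : nat -> T -> R) (K : R) :
  (forall n, P.-integrable setT (EFin \o f n)) ->
  (forall n w, 0 <= f n w) ->
  (forall N, \sum_(0 <= n < N) \int[P]_w f n w <= K) ->
  {ae P, forall w, f n w @[n --> \oo] --> (0 : R)}.
Proof.
move=> fi f0 fK.
pose g w : \bar R := (\sum_(0 <= n <oo) (f n w)%:E)%E.
have mf n := measurable_int P (fi n).
have ig : (\int[P]_w g w <= K%:E)%E.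
  rewrite /g integral_nneseries//; last by move=> n w _; rewrite lee_fin.
  apply: lime_le.
    by apply: is_cvg_nneseries => n _ _; apply: integral_ge0 => w _; rewrite lee_fin.
  apply: nearW => N.
  have -> : (\sum_(0 <= n < N) \int[P]_w (f n w)%:E =
     (\sum_(0 <= n < N) \int[P]_w f n w)%:E)%E.
    rewrite -sumEFin; apply: eq_bigr => n _.
    by rewrite /Rintegral fineK//; exact: (integrable_fin_num measurableT (fi n)).
  by rewrite lee_fin.
have gi : P.-integrable setT g.
  apply/integrableP; split.
    apply: ge0_emeasurable_sum => [n w *|*]; [by rewrite lee_fin f0|exact: mf].
  under eq_integral => w _.
    rewrite gee0_abs; last by apply: nneseries_ge0 => n _ _; rewrite lee_fin.
    over.
  exact: le_lt_trans ig (ltry _).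
have := integrable_ae measurableT gi.
apply: filterS => w /(_ I) gw.
apply: cvg_series_cvg_0.
apply: nnseries_is_cvg => //.
by rewrite -ge0_fin_numE//; apply: nneseries_ge0 => n _ _; rewrite lee_fin.
Qed.

Lemma sum_inv_sq (N : nat) : \sum_(0 <= n < N) ((n.+1)%:R ^- 2 : R) <= 2.
Proof.
(* The sharper bound is what induction can carry: it telescopes through 1/(a+1)^2 <= 1/a -
   1/(a+1). *)
suff H : \sum_(0 <= n < N.+1) ((n.+1)%:R ^- 2 : R) <= 2 - (N.+1)%:R^-1.
  apply: le_trans (_ : _ <= \sum_(0 <= n < N.+1) ((n.+1)%:R ^- 2 : R)) _.
    by rewrite big_nat_recr//= lerDl invr_ge0 exprn_ge0.
  by apply: le_trans H _; rewrite gerBl.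
elim: N => [|N IH]; first by rewrite big_nat1 expr1n invr1; lra.
rewrite big_nat_recr//=; apply: le_trans (lerD IH (lexx _)) _.
rewrite -addrA lerD2l.
have a0 : 0 < N.+1%:R :> R by [].
have -> : N.+2%:R = N.+1%:R + 1 :> R by rewrite -natr1.
move: (N.+1%:R : R) a0 => a a0.
have -> : - a^-1 + (a + 1) ^- 2 = - (a+1)^-1 - (a^-1 * (a + 1) ^- 2).
  have an0 : a != 0 by rewrite gt_eqF.
  have a1n0 : a + 1 != 0 by rewrite gt_eqF// addr_gt0.
  by field; rewrite an0 a1n0.
by rewrite gerBl mulr_ge0// invr_ge0 ?exprn_ge0// ltW// addr_gt0.
Qed.


Lemma square_bracket (m : nat) : (0 < m)%N ->
  exists n, (n.+1 ^ 2 <= m)%N /\ (m < n.+2 ^ 2)%N.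
Proof.
elim: m => // -[|m] IH _; first by exists 0%N.
have [n [n1 n2]] := IH isT.
have [h|h] := ltnP m.+2 (n.+2 ^ 2); first by exists n; split=> //; exact: leqW.
exists n.+1; split=> //.
by apply: (leq_ltn_trans n2); rewrite ltn_sqr.
Qed.

Lemma slln_uncorrelated (Y : nat -> T -> R) (C : R) :
  (forall m n, P.-integrable setT (EFin \o (fun w => Y m w * Y n w))) ->
  (forall n, \int[P]_w (Y n w * Y n w) <= C) ->
  (forall m n, m != n -> \int[P]_w (Y m w * Y n w) = 0) ->
  {ae P, forall w, (\sum_(0 <= a < n) Y a w) / n%:R @[n --> \oo] --> (0 : R)}.
Proof.
move=> iY Y2 Y0.
have C0 : 0 <= C.
  by apply: le_trans (Y2 0%N); apply: Rintegral_ge0 => w _; rewrite -expr2 sqr_ge0.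
(* D n dominates (S_m / m)^2 / 2 for (n+1)^2 <= m < (n+2)^2. *)
pose D n w := ((\sum_(0 <= a < n.+1 ^ 2) Y a w) ^+ 2 +
  \sum_(n.+1 ^ 2 <= m < n.+2 ^ 2) (\sum_(n.+1 ^ 2 <= a < m) Y a w) ^+ 2) / n.+1%:R ^+ 4.
have iS i j : P.-integrable setT (EFin \o (fun w => (\sum_(i <= a < j) Y a w) ^+ 2)).
  by apply: (second_moment_sum iY Y2 Y0 _).1; rewrite iota_uniq.
have ES i j : \int[P]_w ((\sum_(i <= a < j) Y a w) ^+ 2) <= C * (j - i)%:R.
  have := (second_moment_sum iY Y2 Y0 (iota_uniq i (j - i))).2.
  by rewrite size_iota.
have iSS n := @Rintegral_sum _ (index_iota (n.+1 ^ 2) (n.+2 ^ 2))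
  (fun m w => (\sum_(n.+1 ^ 2 <= a < m) Y a w) ^+ 2) (iS _).
have iN n : P.-integrable setT (EFin \o (fun w => (\sum_(0 <= a < n.+1 ^ 2) Y a w) ^+ 2 +
  \sum_(n.+1 ^ 2 <= m < n.+2 ^ 2) (\sum_(n.+1 ^ 2 <= a < m) Y a w) ^+ 2)).
  apply: (eq_integrable _ (fun w => ((\sum_(0 <= a < n.+1 ^ 2) Y a w) ^+ 2)%:E +
    (\sum_(n.+1 ^ 2 <= m < n.+2 ^ 2) (\sum_(n.+1 ^ 2 <= a < m) Y a w) ^+ 2)%:E)%E) => //.
  exact: (integrableD measurableT (iS _ _) (iSS n).2).
have iD n : P.-integrable setT (EFin \o D n).
  apply: (eq_integrable _ (fun w => (((\sum_(0 <= a < n.+1 ^ 2) Y a w) ^+ 2 +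
  \sum_(n.+1 ^ 2 <= m < n.+2 ^ 2) (\sum_(n.+1 ^ 2 <= a < m) Y a w) ^+ 2)%:E *
      (n.+1%:R ^- 4)%:E)%E)) => //.
  by apply: integrableZr => //; exact: iN.
have D0 n w : 0 <= D n w.
  by rewrite divr_ge0// ?exprn_ge0// addr_ge0// ?sqr_ge0// sumr_ge0// => m _;
      rewrite sqr_ge0.
(* The constant is 10 = 1 + 9: the partial sum up to (n+1)^2 costs C(n+1)^2, and the 2n+3
   fluctuations cost at most C(2n+3) each, with (2n+3)^2 <= 9(n+1)^2. *)
have ED n : \int[P]_w D n w <= 10 * C * n.+1%:R ^- 2.
  rewrite /D RintegralZr//.
  rewrite RintegralD//; last exact: (iSS n).2.
  rewrite (iSS n).1.
  have -> : 10 * C * n.+1%:R ^- 2 = (10 * C * n.+1%:R ^+ 2) / n.+1%:R ^+ 4.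
    by field; rewrite addrC natr1 pnatr_eq0.
  rewrite ler_pM2r ?invr_gt0 ?exprn_gt0//.
  apply: (@le_trans _ _ (C * (n.+1 ^ 2)%:R + \sum_(n.+1 ^ 2 <= m < n.+2 ^ 2) C * (2 *
      n.+1 + 1)%:R)).
    apply: lerD; first by have := ES 0%N (n.+1 ^ 2)%N; rewrite subn0.
    rewrite big_nat [leRHS]big_nat; apply: ler_sum => m /andP[m1 m2].
    apply: le_trans (ES _ _) _; rewrite ler_wpM2l// ler_nat.
    by move: m1 m2; nia.
  rewrite sumr_const_nat -[X in _ + X]mulr_natr -[X in _ + X]mulrA -natrM -mulrDr -natrD.
  rewrite [10 * C]mulrC -mulrA.
  rewrite ler_wpM2l// -natrX -natrM ler_nat.
  by nia.
have DK N : \sum_(0 <= n < N) \int[P]_w D n w <= 20 * C.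
  apply: (@le_trans _ _ (\sum_(0 <= n < N) 10 * C * n.+1%:R ^- 2)).
    by apply: ler_sum.
  rewrite -mulr_sumr (_ : 20 * C = 10 * C * 2); last by ring.
  by rewrite ler_wpM2l ?mulr_ge0// sum_inv_sq.
have := ae_cvg0_sum iD D0 DK.
apply: filterS => w Dw.
apply/cvgr0Pnorm_lt => e e0.
(* The half absorbs the factor 2 of (a + b)^2 <= 2(a^2 + b^2), where the sum up to [m] is cut at the
   last square (n+1)^2 <= m. Then S_m^2 < e^2 (n+1)^4 <= e^2 m^2. *)
have e2 : 0 < e ^+ 2 / 2 by rewrite divr_gt0 ?exprn_gt0.
move/cvgr0Pnorm_lt : Dw => /(_ _ e2)[N _ HN].
exists (N.+1 ^ 2)%N => // m /= Nm.
have m0 : (0 < m)%N by apply: leq_trans Nm; rewrite expn_gt0.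
have [n [n1 n2]] := square_bracket m0.
have Nn : (N <= n)%N by move: (leq_ltn_trans Nm n2); rewrite ltn_sqr.
have := HN n Nn; rewrite /= ger0_norm// => Dn.
have mR : 0 < m%:R :> R by rewrite ltr0n.
rewrite -(@ltr_pXn2r _ 2)// ?nnegrE ?ltW// -normrX ger0_norm ?sqr_ge0//.
rewrite expr_div_n ltr_pdivrMr ?exprn_gt0//.
rewrite (big_cat_nat _ n1)//=.
set a := \sum_(0 <= i < n.+1 ^ 2) Y i w; set b := \sum_(n.+1 ^ 2 <= i < m) Y i w.
have ab : (a + b) ^+ 2 <= 2 * (a ^+ 2 + b ^+ 2).
  rewrite -subr_ge0 (_ : _ - _ = (a - b) ^+ 2) ?sqr_ge0//; by ring.
have bD : a ^+ 2 + b ^+ 2 <= D n w * n.+1%:R ^+ 4.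
  rewrite /D divfK ?expf_neq0// lerD2l.
  rewrite (bigD1_seq m) ?iota_uniq//=; last by rewrite mem_index_iota n1.
  by rewrite lerDl sumr_ge0// => i _; rewrite sqr_ge0.
apply: le_lt_trans ab _; apply: le_lt_trans (_ : 2 * (D n w * n.+1%:R ^+ 4) < _).
  by rewrite ler_pM2l.
apply: (@lt_le_trans _ _ (2 * (e ^+ 2 / 2 * n.+1%:R ^+ 4))).
  by rewrite ltr_pM2l// ltr_pM2r ?exprn_gt0.
rewrite mulrA (mulrC 2) divfK// ler_pM2l ?exprn_gt0//.
rewrite (exprM _ 2 2) -natrX lerXn2r ?nnegrE// ler_nat//.
Qed.

End Slln.

(** * Moments of normal laws *)

Section NormalMoments.
Context {R : realType}.
Notation mu := (@lebesgue_measure R).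

(** Both functions have the same integral over every measurable set. Identifying the Radon-Nikodym
    derivative with the explicit density makes the change of variables formula usable for concrete
    integrands. *)
Lemma ae_eq_normal_pdf (m s : R) :
  ae_eq mu setT (Radon_Nikodym_SigmaFinite.f (normal_prob m s) mu)
    (fun x => (normal_pdf m s x)%:E).
Proof.
have dom := normal_prob_dominates m s.
apply: integral_ae_eq => //.
- exact: Radon_Nikodym_SigmaFinite.f_integrable.
- by apply/measurable_EFinP; exact: measurable_normal_pdf.
- by move=> A _ mA; rewrite -Radon_Nikodym_SigmaFinite.f_integral.
Qed.

Lemma ge0_integral_normal_prob (m s : R) (f : R -> \bar R) :
  (forall x, 0 <= f x)%E -> measurable_fun setT f ->
  (\int[normal_prob m s]_x f x = \int[mu]_x (f x * (normal_pdf m s x)%:E))%E.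
Proof.
move=> f0 mf; have dom := normal_prob_dominates m s.
rewrite -(Radon_Nikodym_SigmaFinite.change_of_variables dom)//.
apply: ae_eq_integral => //.
- apply: emeasurable_funM => //; apply: (measurable_int mu).
  exact: Radon_Nikodym_SigmaFinite.f_integrable.
- apply: emeasurable_funM => //.
  by apply/measurable_EFinP; exact: measurable_normal_pdf.
- by apply: ae_eqe_mul2l; exact: ae_eq_normal_pdf.
Qed.

Lemma integral_normal_prob (m s : R) (f : R -> \bar R) :
  (normal_prob m s).-integrable setT f ->
  (\int[normal_prob m s]_x f x = \int[mu]_x (f x * (normal_pdf m s x)%:E))%E.
Proof.
move=> fi; rewrite integralE [RHS]integralE.
have mf := measurable_int _ fi.
rewrite !ge0_integral_normal_prob//; [|exact: measurable_funeneg|exact: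
    measurable_funepos].
have p0 x : (0 <= (normal_pdf m s x)%:E)%E by rewrite lee_fin normal_pdf_ge0.
congr (_ - _)%E; apply: eq_integral => x _.
  by rewrite !funeposE maxe_pMl// mul0e.
by rewrite !funenegE maxe_pMl// mul0e muleC muleN muleC.
Qed.

Lemma integrable_normal_prob4 (s : R) : s != 0 ->
  (normal_prob 0 s).-integrable setT (fun x => (x ^+ 4)%:E).
Proof.
move=> s0; apply/integrableP; split.
  by apply/measurable_EFinP; exact: measurable_funX.
under eq_integral do rewrite gee0_abs ?lee_fin ?exprn_even_ge0//.
rewrite ge0_integral_normal_prob//; last 2 first.
- by move=> x; rewrite lee_fin exprn_even_ge0.
- by apply/measurable_EFinP; exact: measurable_funX.
have s20 : s * 2 != 0 by rewrite mulf_neq0.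
(* With u = x^2 / (8 s^2), x^4 e^{-4u} = 64 s^4 u^2 e^{-4u} <= 64 s^4 e^{-u},
   a multiple of the density with standard deviation 2s. *)
pose K : R := 64 * s ^+ 4 * normal_peak s / normal_peak (s * 2).
apply: (@le_lt_trans _ _ (\int[mu]_x (K%:E * (normal_pdf 0 (s * 2) x)%:E))%E).
  apply: ge0_le_integral => //.
  - by move=> x _; rewrite mule_ge0 ?lee_fin ?exprn_even_ge0 ?normal_pdf_ge0.
  - apply/measurable_EFinP; apply: measurable_funM; first exact: measurable_funX.
    exact: measurable_normal_pdf.
  - apply/measurable_EFinP; apply: measurable_funM => //.
    exact: measurable_normal_pdf.
  move=> x _; rewrite -!EFinM lee_fin !normal_pdfE//.
  rewrite /normal_fun subr0.
  set u := x ^+ 2 / ((s * 2) ^+ 2 *+ 2).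
  have u0 : 0 <= u by rewrite divr_ge0 ?sqr_ge0// mulrn_wge0// sqr_ge0.
  have xE : x ^+ 4 = 64 * s ^+ 4 * u ^+ 2 by rewrite /u; field.
  have -> : - x ^+ 2 / ((s * 2) ^+ 2 *+ 2) = - u by rewrite mulNr.
  have -> : - x ^+ 2 / (s ^+ 2 *+ 2) = 4%:R * - u by rewrite /u; field.
  rewrite expRM_natl xE /K.
  set e := expR (- u).
  have e0 : 0 < e by exact: expR_gt0.
  have e1 : e <= 1 by rewrite -expR0 ler_expR oppr_le0.
  have ue : u * e <= 1.
    rewrite /e expRN ler_pdivrMr ?expR_gt0// mul1r.
    by apply: le_trans (expR_ge1Dx u); rewrite lerDr.
  have pn : normal_peak (s * 2) != 0 by rewrite gt_eqF// normal_peak_gt0.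
  have -> : 64 * s ^+ 4 * normal_peak s / normal_peak (s * 2) * (normal_peak (s * 2) * e)
    = 64 * s ^+ 4 * normal_peak s * e by field.
  have -> : 64 * s ^+ 4 * u ^+ 2 * (normal_peak s * e ^+ 4) =
    64 * s ^+ 4 * normal_peak s * ((u * e) ^+ 2 * e ^+ 2) by ring.
  rewrite ler_wpM2l//.
    by rewrite mulr_ge0 ?normal_peak_ge0// mulr_ge0// exprn_even_ge0.
  apply: (@le_trans _ _ (1 * e)); last by rewrite mul1r.
  have ue0 : 0 <= u * e by rewrite mulr_ge0// ltW.
  apply: ler_pM; rewrite ?sqr_ge0//; first by rewrite exprn_ile1.
  by rewrite expr2 ler_piMl// ltW.
rewrite integralZl//; last exact: integrable_normal_pdf.
by rewrite integral_normal_pdf mule1 ltry.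
Qed.

(** The fundamental theorem on [-(n+1), n+1] followed by dominated convergence, with |g| as
    dominating function. The shift to n+1 keeps the interval nondegenerate. *)
Lemma integral_setT_FTC (g G : R -> R) (l : R) :
  continuous g -> (forall x : R, is_derive x 1 G (g x)) ->
  mu.-integrable setT (EFin \o g) ->
  G n.+1%:R - G (- n.+1%:R) @[n --> \oo] --> l ->
  (\int[mu]_x (g x)%:E = l%:E)%E.
Proof.
move=> cg dG ig Gl.
pose I n : set R := `[- n.+1%:R, n.+1%:R]%classic.
pose f_ n (x : R) : \bar R := ((EFin \o g) \_ (I n)) x.
have cG : continuous G.
  by move=> x; apply: differentiable_continuous; apply/derivable1_diffP; exact: ex_derive.
have intf n : (\int[mu]_x f_ n x = (G n.+1%:R - G (- n.+1%:R))%:E)%E.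
  rewrite /f_ -integral_mkcond EFinB (@continuous_FTC2 _ g G)//.
  - by rewrite ltrNl (@lt_trans _ _ 0)// oppr_lt0.
  - by apply: continuous_subspaceT.
  - split; first by move=> x _; exact: ex_derive.
      by apply: cvg_at_right_filter; exact: cG.
    by apply: cvg_at_left_filter; exact: cG.
  - by move=> x _; rewrite derive1E; exact: derive_val.
have mg : measurable_fun setT (EFin \o g) := measurable_int _ ig.
have DC := @dominated_convergence _ _ R mu setT measurableT f_ (EFin \o g)
  (abse \o EFin \o g).
case: DC => [|||||_ _ H].
- move=> n; rewrite /f_ -measurable_restrict//; last exact: measurable_itv.
  exact: measurable_funTS.
- exact: mg.
- apply: aeW => x _; apply: (@cvg_near_cst _ _ ((EFin \o g) x)).
  have [N _ HN] := nbhs_infty_ger `|x|.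
  exists N => // n /= Nn; rewrite /f_ patchE ifT//.
  rewrite inE /I /= in_itv/= -ler_norml.
  by apply: (@le_trans _ _ n%:R); [exact: HN|rewrite ler_nat].
- exact: integrable_abse.
- apply: aeW => x n _; rewrite /f_ patchE; case: ifP => _ //=.
  by rewrite normr0 lee_fin.
rewrite (funext intf) in H.
have H2 : (G n.+1%:R - G (- n.+1%:R))%:E @[n --> \oo] --> l%:E.
  by apply: cvg_EFin => //; exact: nearW.
exact: (cvg_unique _ H H2).
Qed.

Lemma is_derive_normal_pdf (s x : R) : s != 0 ->
  is_derive x 1 (normal_pdf 0 s) (- (x / s ^+ 2) * normal_pdf 0 s x).
Proof.
move=> s0; rewrite normal_pdfE// /normal_fun.
apply: is_derive_eq; rewrite subr0.
move: (expR _) (normal_peak s) => e p; rewrite /GRing.scale/=.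
by field.
Qed.

Lemma normal_pdfN (s x : R) : s != 0 ->
  normal_pdf 0 s (- x) = normal_pdf 0 s x.
Proof.
by move=> s0; rewrite normal_pdfE// /normal_fun !subr0 sqrrN.
Qed.

(** This is the boundary term of the second moment. From exp t >= t at t = N^2 / (2 s^2), N times
    the density at N is at most the peak times 2 s^2 / N. *)
Lemma cvg_mul_normal_pdf (s : R) : s != 0 ->
  n.+1%:R * normal_pdf 0 s n.+1%:R @[n --> \oo] --> (0 : R).
Proof.
move=> s0.
apply: (@squeeze_cvgr _ _ _ _ (fun=> 0) (fun n => normal_peak s * (s ^+ 2 *+ 2) *
    n.+1%:R^-1)).
- apply: nearW => n; apply/andP; split.
    by rewrite mulr_ge0// normal_pdf_ge0.
  rewrite normal_pdfE// /normal_fun subr0.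
  have N0 : 0 < n.+1%:R :> R by [].
  have k0 : 0 < s ^+ 2 *+ 2 by rewrite mulrn_wgt0// exprn_even_gt0.
  move: (n.+1%:R : R) (s ^+ 2 *+ 2) N0 k0 => N k N0 k0.
  have [Nn0 kn0] : N != 0 /\ k != 0 by rewrite !gt_eqF.
  rewrite mulrCA -mulrA ler_wpM2l ?normal_peak_ge0//.
  rewrite mulNr expRN ler_pdivrMr ?expR_gt0//.
  apply: (@le_trans _ _ (k / N * (N ^+ 2 / k))).
    rewrite le_eqVlt; apply/orP; left; apply/eqP; field; rewrite ?kn0 ?Nn0//.
  rewrite ler_pM2l ?divr_gt0//.
  by apply: le_trans (expR_ge1Dx _); rewrite lerDr.
- exact: cvg_cst.
- rewrite -[0](mulr0 (normal_peak s * (s ^+ 2 *+ 2))).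
  apply: cvgM; first exact: cvg_cst.
  exact: cvg_harmonic.
Qed.

Lemma integrable_normal_prob12 (s : R) : s != 0 ->
  (normal_prob 0 s).-integrable setT (fun x : R => x%:E) /\
  (normal_prob 0 s).-integrable setT (fun x : R => (x ^+ 2)%:E).
Proof.
move=> s0; have i4 := integrable_normal_prob4 s0.
have i2 : (normal_prob 0 s).-integrable setT (fun x => (x ^+ 2)%:E).
  apply: (@le_integrable _ _ _ (normal_prob 0 s) _ measurableT _ (fun x : R => (1 + x ^+
      4)%:E)) => //.
  - by apply/measurable_EFinP; exact: measurable_funX.
  - move=> x _; rewrite lee_fin !ger0_norm ?sqr_ge0 ?addr_ge0 ?exprn_even_ge0//.
    by nra.
  - under eq_fun do rewrite EFinD.
    apply: integrableD => //; exact: finite_measure_integrable_cst.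
have i1 : (normal_prob 0 s).-integrable setT (fun x => x%:E).
  apply: (@le_integrable _ _ _ (normal_prob 0 s) _ measurableT _ (fun x : R => (1 + x ^+
      2)%:E)) => //.
  - by apply/measurable_EFinP.
  - move=> x _; rewrite lee_fin [leRHS]ger0_norm ?addr_ge0 ?sqr_ge0//.
    by rewrite ler_norml; nra.
  - under eq_fun do rewrite EFinD.
    apply: integrableD => //; exact: finite_measure_integrable_cst.
by [].
Qed.

(** With p the density, p' = -(x / s^2) p. Hence -s^2 p is an antiderivative of x p, and -s^2 x p is
    one of (x^2 - s^2) p. *)
Lemma normal_moments (s : R) : s != 0 ->
  (\int[normal_prob 0 s]_x x%:E = 0)%E /\ (\int[normal_prob 0 s]_x (x ^+ 2)%:E = (s ^+
      2)%:E)%E.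
Proof.
move=> s0.
have [i1 i2] := integrable_normal_prob12 s0.
have mp := measurable_normal_pdf 0 s.
have ci f : (normal_prob 0 s).-integrable setT (EFin \o f) ->
    mu.-integrable setT (EFin \o (fun x => f x * normal_pdf 0 s x)).
  move=> fi; have mf : measurable_fun setT f by apply/measurable_EFinP;
      exact: measurable_int fi.
  apply/integrableP; split.
    by apply/measurable_EFinP; apply: measurable_funM.
  have /integrableP[_] := fi; apply: le_lt_trans.
  rewrite ge0_integral_normal_prob//; last first.
    by apply: measurableT_comp => //; exact: measurable_int fi.
  apply: ge0_le_integral => //.
  - by apply: measurableT_comp => //; apply/measurable_EFinP; exact: measurable_funM.
  - apply: emeasurable_funM; last exact/measurable_EFinP.
    by apply: measurableT_comp => //; exact: measurable_int fi.
  - by move=> x _; rewrite /= normrM EFinM (ger0_norm (normal_pdf_ge0 _ _ _)).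
have cpdf := @continuous_normal_pdf R 0 s s0.
split.
  rewrite integral_normal_prob//.
  under eq_integral do rewrite -EFinM.
  apply: (@integral_setT_FTC _ (fun x => - s ^+ 2 * normal_pdf 0 s x)).
  - by move=> x; apply: cvgM; [exact: cvg_id|exact: cpdf].
  - move=> x; have D := is_derive_normal_pdf x s0.
    apply: is_derive_eq; rewrite /GRing.scale/=; by field.
  - exact: (ci id).
  - apply: cvg_near_cst; apply: nearW => n.
    by rewrite normal_pdfN// subrr.
(* The second moment is centred first: x^2 p alone has no elementary antiderivative, whereas (x^2 -
   s^2) p has one that vanishes at both ends. *)
have ib : (normal_prob 0 s).-integrable setT (EFin \o (fun x : R => x ^+ 2 - s ^+ 2)).
  apply: (@eq_integrable _ _ _ (normal_prob 0 s) _ measurableT (fun x : R => (x ^+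
      2)%:E - (s ^+ 2)%:E)%E) => //.
  by apply: integrableB => //; exact: finite_measure_integrable_cst.
have -> : (s ^+ 2)%:E = (0 + (s ^+ 2)%:E * 1)%E by rewrite add0e mule1.
have ip := @integrable_normal_pdf R 0 s.
have H0 : (\int[mu]_x ((x ^+ 2 - s ^+ 2) * normal_pdf 0 s x)%:E = 0)%E.
  apply: (@integral_setT_FTC _ (fun x => - s ^+ 2 * (x * normal_pdf 0 s x))).
  - move=> x; apply: cvgM; last exact: cpdf.
    apply: cvgB; last exact: cvg_cst.
    exact: exprn_continuous.
  - move=> x; have D := is_derive_normal_pdf x s0.
    apply: is_derive_eq; rewrite /GRing.scale/=; by field.
  - apply: (ci (fun x => x ^+ 2 - s ^+ 2)).
    exact: ib.
  - rewrite (_ : (fun n => _) = (fun n => - s ^+ 2 * 2 * (n.+1%:R *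
      normal_pdf 0 s n.+1%:R))); last first.
      by apply/funext => n; rewrite normal_pdfN//; ring.
    rewrite -[X in _ --> X](mulr0 (- s ^+ 2 * 2)).
    by apply: cvgM; [exact: cvg_cst|exact: cvg_mul_normal_pdf].
rewrite -H0 -(@integral_normal_pdf R 0 s) -integralZl//.
rewrite integral_normal_prob// -integralD//.
- by apply: eq_integral => x _; rewrite -!EFinM -EFinD -mulrDl subrK.
- apply: (ci (fun x => x ^+ 2 - s ^+ 2)).
  exact: ib.
- exact: integrableZl.
Qed.

(** * Transfer of moments from a law to the random variables that follow it *)

Section Law.
Context {d : measure_display} {T : measurableType d} (P : probability T R).

(* [measurableTypeR R], the carrier of [normal_prob], and [R] are convertible as
   types but their measures do not unify. *)
Lemma law_integral (m : {measure set (measurableTypeR R) -> \bar R}) (G : T ->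
    R) (f : R -> R) :
  measurable_fun setT G -> measurable_fun setT f ->
  (forall A : set R, measurable A -> P (G @^-1` A) = m A) ->
  m.-integrable setT (EFin \o f) ->
  P.-integrable setT (EFin \o (f \o G)) /\ \int[P]_w f (G w) = \int[m]_x f x.
Proof.
move=> mG mf law fi.
have mG' : measurable_fun setT (G : T -> measurableTypeR R) := mG.
pose G' : {mfun T >-> measurableTypeR R} := HB.pack (G : T ->
    measurableTypeR R) (isMeasurableFun.Build _ _ _ _ (G : T -> measurableTypeR R) mG').
have E (g : measurableTypeR R -> \bar R) : (\int[pushforward P G']_x g x =
    \int[m]_x g x)%E.
  by apply: eq_measure_integral => A mA _; exact: law.
have mEf : measurable_fun setT (EFin \o f) by exact/measurable_EFinP.
have iP : P.-integrable setT (EFin \o (f \o G)).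
  apply/integrableP; split.
    by apply/measurable_EFinP; exact: measurableT_comp.
  have /integrableP[_] := fi; apply: le_lt_trans.
  rewrite -E ge0_integral_pushforward//.
  exact: measurableT_comp.
split=> //; rewrite /Rintegral; congr fine.
by rewrite -E integral_pushforward.
Qed.

(** [K] is chosen before [G], so one fourth moment serves all antennas at once and yields the
    uniform second-moment bound of the strong law. *)
Lemma centered_normal_moments (v : R) : 0 <= v -> exists K : R, forall G : T -> R,
  measurable_fun setT G ->
  (forall A : set R, measurable A -> P (G @^-1` A) = centered_normal v A) ->
  [/\ P.-integrable setT (EFin \o (fun w => G w ^+ 4)), \int[P]_w G w = 0,
      \int[P]_w (G w ^+ 2) = v & \int[P]_w (G w ^+ 4) = K].
Proof.
move=> v0; have mX n : measurable_fun setT (fun x : R => x ^+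
    n) by exact: measurable_funX.
have [vz|vn0] := eqVneq v 0.
  exists 0 => G mG law.
  have lawd A : measurable A -> P (G @^-1` A) = (\d_(0 : measurableTypeR R) : {measure
      set (measurableTypeR R) -> \bar R}) A.
    by move=> mA; rewrite law// /centered_normal vz eqxx.
  have di (f : R -> R) : measurable_fun setT f ->
      (\d_(0 : measurableTypeR R) : {measure set (measurableTypeR R) ->
          \bar R}).-integrable setT (EFin \o f) /\
      \int[(\d_(0 : measurableTypeR R) : {measure set (measurableTypeR R) ->
          \bar R})]_x f x = f 0.
    move=> mf; split.
      apply/integrableP; split; first exact/measurable_EFinP.
      rewrite integral_dirac//; last by apply: measurableT_comp => //;
          exact/measurable_EFinP.
      by rewrite diracT mul1e ltry.
    rewrite /Rintegral integral_dirac//; last exact/measurable_EFinP.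
    by rewrite diracT mul1e.
  split.
  - exact: (law_integral mG (mX 4%N) lawd (di _ (mX 4%N)).1).1.
  - rewrite (law_integral mG (mX 1%N) lawd (di _ (mX 1%N)).1).2.
    by rewrite (di _ (mX 1%N)).2 expr1.
  - rewrite (law_integral mG (mX 2%N) lawd (di _ (mX 2%N)).1).2.
    by rewrite (di _ (mX 2%N)).2 expr0n vz.
  - rewrite (law_integral mG (mX 4%N) lawd (di _ (mX 4%N)).1).2.
    by rewrite (di _ (mX 4%N)).2 expr0n.
have s0 : Num.sqrt v != 0 by rewrite sqrtr_eq0 -ltNge lt_neqAle eq_sym vn0.
have i4 := integrable_normal_prob4 s0.
pose nu : {measure set (measurableTypeR R) -> \bar R} := normal_prob 0 (Num.sqrt v).
have [m1 m2] := normal_moments s0.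
have [i1 i2] := integrable_normal_prob12 s0.
exists (\int[nu]_x x ^+ 4) => G mG law.
have lawn A : measurable A -> P (G @^-1` A) = normal_prob 0 (Num.sqrt v) A.
  by move=> mA; rewrite law// /centered_normal (negbTE vn0).
split.
- exact: (@law_integral nu G (fun x => x ^+ 4) mG (mX 4%N) lawn i4).1.
- by rewrite (@law_integral nu G (fun x => x ^+ 1) mG (mX 1%N) lawn i1).2 /Rintegral m1.
- by rewrite (@law_integral nu G (fun x => x ^+ 2) mG (mX 2%N) lawn i2).2 /Rintegral
    m2/= sqr_sqrtr.
- exact: (@law_integral nu G (fun x => x ^+ 4) mG (mX 4%N) lawn i4).2.
Qed.

Lemma centered_normalT (v : R) : centered_normal v setT = 1%E.
Proof.
rewrite /centered_normal; case: ifPn => _; first by rewrite diracT.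
by rewrite probability_setT.
Qed.

Lemma complex_normal_law (v : R) (Z : T -> R[i]) : complex_normal P v Z ->
  [/\ measurable_fun setT (fun w => complex.Re (Z w)),
      measurable_fun setT (fun w => complex.Im (Z w)),
      forall A : set R, measurable A ->
        P ((fun w => complex.Re (Z w)) @^-1` A) = centered_normal (v / 2) A &
      forall A : set R, measurable A ->
        P ((fun w => complex.Im (Z w)) @^-1` A) = centered_normal (v / 2) A].
Proof.
move=> [mZ law]; have /measurable_fun_pairP[m1 m2] := mZ; split=> // A mA.
  rewrite -[RHS]mule1 -(centered_normalT (v / 2)) -law//.
  by congr (P _); rewrite eqEsubset; split=> w //= [].
rewrite -[RHS]mul1e -(centered_normalT (v / 2)) -law//.
by congr (P _); rewrite eqEsubset; split=> w //= [].
Qed.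

End Law.

Lemma normal_prob_itv_gt0 (s a b : R) : s != 0 -> a < b ->
  (0 < normal_prob 0 s `]a, b[%classic)%E.
Proof.
move=> s0 ab.
(* On ]a, b[ one has x^2 <= a^2 + b^2 whatever the signs, so the density is at least the constant
   [c] there. *)
pose K := a ^+ 2 + b ^+ 2.
pose c := normal_peak s * expR (- K / (s ^+ 2 *+ 2)).
have c0 : 0 < c by rewrite mulr_gt0 ?expR_gt0 ?normal_peak_gt0.
apply: (@lt_le_trans _ _ (\int[mu]_(x in `]a, b[%classic) c%:E)%E).
  rewrite integral_cst//= lebesgue_measure_itv/= lte_fin ab -EFinB -EFinM lte_fin.
  by rewrite mulr_gt0// subr_gt0.
rewrite /normal_prob; apply: ge0_le_integral => //.
- by move=> x _; rewrite lee_fin ltW.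
- by apply/measurable_EFinP; apply: measurable_funTS; exact: measurable_normal_pdf.
move=> x /=; rewrite in_itv/= => /andP[ax xb]; rewrite lee_fin normal_pdfE//.
rewrite ler_wpM2l ?normal_peak_ge0// /normal_fun subr0 ler_expR.
rewrite ler_pM2r ?invr_gt0 ?mulrn_wgt0 ?exprn_even_gt0//.
rewrite lerN2 /K; have [x0|x0] := leP 0 x.
  by rewrite -[leLHS]add0r lerD ?sqr_ge0// lerXn2r ?nnegrE ?(ltW xb)// (le_trans x0 (ltW
      xb)).
by rewrite -[leLHS]addr0 lerD ?sqr_ge0//; nra.
Qed.


End NormalMoments.

(** * Independence *)

Section Independence.
Context {R : realType} {d : measure_display} {T : measurableType d}.
Variable P : probability T R.

Definition indep_rv d1 d2 (T1 : measurableType d1) (T2 : measurableType d2)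
    (X : T -> T1) (Y : T -> T2) : Prop :=
  forall A B, measurable A -> measurable B ->
    P (X @^-1` A `&` Y @^-1` B) = (P (X @^-1` A) * P (Y @^-1` B))%E.

(** Independence says that the law of the pair agrees with the product of the marginals on
    rectangles, hence everywhere; Fubini then separates the integral. *)
Lemma product_expectation d1 d2 (T1 : measurableType d1) (T2 : measurableType d2)
    (X : T -> T1) (Y : T -> T2) (f : T1 -> R) (g : T2 -> R) :
  measurable_fun setT X -> measurable_fun setT Y -> indep_rv X Y ->
  measurable_fun setT f -> measurable_fun setT g ->
  P.-integrable setT (EFin \o (f \o X)) -> P.-integrable setT (EFin \o (g \o Y)) ->
  P.-integrable setT (EFin \o (fun w => f (X w) * g (Y w))) ->
  \int[P]_w (f (X w) * g (Y w)) = \int[P]_w f (X w) * \int[P]_w g (Y w).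
Proof.
move=> mX mY XY mf mg fi gi fgi.
pose X' : {mfun T >-> T1} := HB.pack X (isMeasurableFun.Build _ _ _ _ X mX).
pose Y' : {mfun T >-> T2} := HB.pack Y (isMeasurableFun.Build _ _ _ _ Y mY).
pose Z w := (X w, Y w).
have mZ : measurable_fun setT Z by exact: measurable_fun_pair.
pose Z' : {mfun T >-> (T1 * T2)%type} := HB.pack Z (isMeasurableFun.Build _ _ _ _ Z mZ).
have mh : measurable_fun setT (fun z : T1 * T2 => f z.1 * g z.2).
  apply: measurable_funM.
    exact: (measurableT_comp mf measurable_fst).
  exact: (measurableT_comp mg measurable_snd).
have mEh : measurable_fun setT (fun z : T1 * T2 => (f z.1 *
    g z.2)%:E) by exact/measurable_EFinP.
pose mu1 := distribution P X'; pose mu2 := distribution P Y';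
    pose muZ := distribution P Z'.
have law A : measurable A -> (mu1 \x mu2)%E A = muZ A.
  by apply: product_measure_unique => B C mB mC; exact: XY.
have hi : (mu1 \x mu2)%E.-integrable setT (fun z : T1 * T2 => (f z.1 * g z.2)%:E).
  have /integrableP[_ hP] := integrable_pushforward mZ mEh fgi measurableT.
  apply/integrableP; split=> //; move: hP; apply: le_lt_trans.
  by rewrite (@eq_measure_integral _ _ _ _ muZ)// => A mA _; exact: law.
have E1 : (\int[P]_w (f (X w) * g (Y w))%:E = \int[mu1]_x \int[mu2]_y (f x * g y)%:E)%E.
  transitivity (\int[muZ]_z (f z.1 * g z.2)%:E)%E.
    by rewrite integral_pushforward.
  rewrite -(@eq_measure_integral _ _ _ _ muZ (mu1 \x mu2)%E); last by move=> A mA _;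
      exact: law.
  by rewrite -integral12_prod_meas1.
have mEf : measurable_fun setT (EFin \o f) by exact/measurable_EFinP.
have mEg : measurable_fun setT (EFin \o g) by exact/measurable_EFinP.
have if1 := integrable_pushforward mX mEf fi measurableT.
have ig2 := integrable_pushforward mY mEg gi measurableT.
rewrite {1}/Rintegral E1.
have -> : (\int[mu1]_x \int[mu2]_y (f x * g y)%:E = \int[mu1]_x (f x)%:E *
    \int[mu2]_y (g y)%:E)%E.
  have gf : (\int[mu2]_y (g y)%:E)%E \is a fin_num by exact: integrable_fin_num.
  rewrite -(fineK gf) -integralZr//.
  apply: eq_integral => x _; rewrite fineK// -integralZl//.
by rewrite fineM ?integrable_fin_num// !integral_pushforward.
Qed.

(** As functions of [C], both sides are finite measures that agree on rectangles, a generating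
    family stable under intersection. Keeping [D] an arbitrary event allows the lemma to be
    iterated, adding one variable at a time. *)
Lemma indep_rv_pair d1 d2 (T1 : measurableType d1) (T2 : measurableType d2)
    (X : T -> T1) (Y : T -> T2) (D : set T) :
  measurable_fun setT X -> measurable_fun setT Y -> measurable D ->
  (forall A B, measurable A -> measurable B ->
    P (X @^-1` A `&` Y @^-1` B `&` D) = (P (X @^-1` A `&` Y @^-1` B) * P D)%E) ->
  forall C, measurable C ->
    P ((fun w => (X w, Y w)) @^-1` C `&` D) = (P ((fun w => (X w, Y w)) @^-1` C) * P D)%E.
Proof.
move=> mX mY mD H C mC.
pose Z w := (X w, Y w).
have mZ : measurable_fun setT Z by exact: measurable_fun_pair.
pose m1 : {measure set (T1 * T2) -> \bar R} := pushforward (mrestr P mD) Z.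
have PD0 : 0 <= fine (P D) by rewrite fine_ge0.
pose m2 : {measure set (T1 * T2) -> \bar R} := mscale (NngNum PD0) (pushforward P Z).
have PDf : P D \is a fin_num by exact: fin_num_measure.
have m1E A : m1 mZ A = P (Z @^-1` A `&` D) by [].
have m2E A : m2 mZ A = (P D * P (Z @^-1` A))%E.
  by rewrite -[in RHS](fineK PDf).
suff: m1 mZ C = m2 mZ C.
  by rewrite m1E m2E muleC.
pose G : set (set (T1 * T2)) :=
  [set A `*` B | A in measurable & B in measurable].
apply: (measure_unique G (fun=> setT)) => //.
- exact: measurable_prod_measurableType.
- move=> _ _ [A1 mA1 [B1 mB1 <-]] [A2 mA2 [B2 mB2 <-]].
  rewrite -setXI; exists (A1 `&` A2); first exact: measurableI.
  by exists (B1 `&` B2) => //; exact: measurableI.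
- by move=> _; exists setT => //; exists setT => //; rewrite setXTT.
- by rewrite bigcup_const.
- move=> _ [A mA [B mB <-]].
  change (m1 mZ (A `*` B) = m2 mZ (A `*` B)).
  by rewrite m1E m2E muleC; exact: H.
- move=> _; rewrite m1E preimage_setT setTI.
  by rewrite -ge0_fin_numE.
Qed.

Lemma mutually_independent2 (I : choiceType) (Z : I -> T -> R[i]) (i j : I) :
  mutually_independent P Z -> i != j ->
  indep_rv (complex_pair \o Z i) (complex_pair \o Z j).
Proof.
move=> indZ ij A B mA mB.
have := indZ [:: i; j] (fun k => if k == i then A else B).
rewrite /= inE ij => /(_ isT) => /(_ (fun k => ltac:(by case: ifP))).
rewrite !big_cons big_nil mule1 eqxx eq_sym (negbTE ij) => <-.
congr (P _); rewrite eqEsubset; split=> w /=.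
  by move=> [wA wB] k /=; rewrite !inE => /orP[]/eqP ->;
      rewrite ?eqxx// eq_sym (negbTE ij).
move=> H; split; first by have := H i; rewrite /= !inE eqxx; exact.
by have := H j; rewrite /= !inE eqxx orbT eq_sym (negbTE ij); exact.
Qed.


End Independence.

(** * Laws of large numbers for complex normal families *)

Section TapLimits.
Context {R : realType} {d : measure_display} {T : measurableType d}.
Variable P : probability T R.

Lemma mutually_independent4 (I : choiceType) (Z : I -> T -> R[i]) (i j k l : I)
    (A B C D : set (R * R)) :
  mutually_independent P Z -> uniq [:: i; j; k; l] ->
  measurable A -> measurable B -> measurable C -> measurable D ->
  P ((complex_pair \o Z i) @^-1` A `&` (complex_pair \o Z j) @^-1` B `&`
     (complex_pair \o Z k) @^-1` C `&` (complex_pair \o Z l) @^-1` D) =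
  (P ((complex_pair \o Z i) @^-1` A) * (P ((complex_pair \o Z j) @^-1` B) *
     (P ((complex_pair \o Z k) @^-1` C) * P ((complex_pair \o Z l) @^-1` D))))%E.
Proof.
move=> indZ u mA mB mC mD.
pose S m := if m == i then A else if m == j then B else if m == k then C else D.
have mS m : measurable (S m) by rewrite /S; case: ifP => // _; case: ifP => // _;
    case: ifP.
have := indZ [:: i; j; k; l] S u mS; rewrite /S.
move: u; rewrite /= !inE !negb_or !andbT => /and3P[/and3P[ij ik il] /andP[jk jl] kl].
rewrite !big_cons big_nil mule1 !eqxx.
have E (a b : I) : a != b -> (a == b = false) * (b == a = false).
  by move=> ab; split; [exact: negbTE|rewrite eq_sym; exact: negbTE].
have EE := (E _ _ ij, E _ _ ik, E _ _ il, E _ _ jk, E _ _ jl, E _ _ kl).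
rewrite !EE => <-.
congr (P _); rewrite eqEsubset; split=> w /=.
  by move=> [[[wA wB] wC] wD] m /=; rewrite !inE => /or4P[]/eqP ->; rewrite ?eqxx ?EE.
move=> H; have Hi := H i; have Hj := H j; have Hk := H k; have Hl := H l.
move: Hi Hj Hk Hl; rewrite /= !inE !eqxx !orbT /= !EE.
by move=> /(_ isT) ? /(_ isT) ? /(_ isT) ? /(_ isT) ?.
Qed.

Definition L4 (f : T -> R) : Prop :=
  measurable_fun setT f /\ P.-integrable setT (EFin \o (fun w => f w ^+ 4)).

Lemma integrable_dominated (f g : T -> R) :
  measurable_fun setT g -> P.-integrable setT (EFin \o f) ->
  (forall w, `|g w| <= f w) -> P.-integrable setT (EFin \o g).
Proof.
move=> mg fi gf; apply: (le_integrable measurableT _ _ fi).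
  exact/measurable_EFinP.
by move=> w _; rewrite /= lee_fin (le_trans (gf w))// ler_norm.
Qed.

Lemma integrable_powers4 (f : T -> R) : L4 f ->
  P.-integrable setT (EFin \o f) /\ P.-integrable setT (EFin \o (fun w => f w ^+ 2)).
Proof.
move=> [mf f4].
have i1 : P.-integrable setT (EFin \o (fun w => 1 + f w ^+ 4)).
  apply: (@eq_integrable _ _ _ P _ measurableT (fun w => 1%:E + (f w ^+ 4)%:E)%E) => //.
  by apply: integrableD => //; exact: finite_measure_integrable_cst.
split.
  apply: (integrable_dominated _ i1) => // w.
  have [f1|f1] := leP `|f w| 1.
    by rewrite (le_trans f1)// lerDl exprn_even_ge0.
  rewrite (le_trans (_ : _ <= `|f w| ^+ 4))//; first by rewrite ler_eXnr// ltW.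
  by rewrite -normrX ger0_norm ?exprn_even_ge0// lerDr.
apply: (integrable_dominated _ i1); first exact: measurable_funX.
by move=> w; rewrite ger0_norm ?sqr_ge0//; nra.
Qed.

(** Applying uv <= u^2 + v^2 twice bounds |xyzt| by x^4 + y^4 + z^4 + t^4. *)
Lemma integrable_mul4 (a b c e : T -> R) : L4 a -> L4 b -> L4 c -> L4 e ->
  P.-integrable setT (EFin \o (fun w => a w * b w * c w * e w)).
Proof.
move=> [ma a4] [mb b4] [mc c4] [me e4].
have i1 : P.-integrable setT (EFin \o (fun w => a w ^+ 4 + b w ^+ 4 + c w ^+ 4 + e w ^+
    4)).
  apply: (@eq_integrable _ _ _ P _ measurableT (fun w => (a w ^+ 4)%:E + (b w ^+ 4)%:E +
      (c w ^+ 4)%:E + (e w ^+ 4)%:E)%E) => //.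
  by do !apply: integrableD => //.
apply: (integrable_dominated _ i1).
  by do !apply: measurable_funM.
move=> w; move: (a w) (b w) (c w) (e w) => x y z t.
have am (u v : R) : u * v <= u ^+ 2 + v ^+ 2 by nra.
rewrite !normrM -mulrA; apply: le_trans (am _ _) _.
have := am (z ^+ 2) (t ^+ 2); have := am (x ^+ 2) (y ^+ 2).
rewrite -![_ ^+ 2 ^+ 2]exprM => h1 h2.
rewrite (exprMn 2 `|x|) (exprMn 2 `|z|) !real_normK ?num_real//.
by rewrite -[leRHS]addrA; exact: lerD.
Qed.

(** The boolean selects the real part ([true]) or the imaginary part ([false]), so that one strong
    law covers all combinations of parts. *)
Definition component (b : bool) (z : R * R) : R := if b then z.1 else z.2.

Lemma measurable_component b : measurable_fun setT (component b).
Proof. by case: b; [exact: measurable_fst|exact: measurable_snd]. Qed.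

Definition complex_part (b : bool) (Z : T -> R[i]) (w : T) : R :=
    component b (complex_pair (Z w)).

Lemma complex_part_moments (v : R) : 0 <= v -> exists K : R, forall b Z,
    complex_normal P v Z ->
  [/\ L4 (complex_part b Z), \int[P]_w complex_part b Z w = 0,
      \int[P]_w (complex_part b Z w ^+ 2) = v / 2 & \int[P]_w (complex_part b Z w ^+
          4) = K].
Proof.
move=> v0; have v20 : 0 <= v / 2 by rewrite divr_ge0.
have [K HK] := centered_normal_moments P v20.
exists K => b Z /complex_normal_law[mR mI lR lI].
have [mp lp] : measurable_fun setT (complex_part b Z) /\
    (forall A : set R, measurable A -> P (complex_part b Z @^-1` A) =
        centered_normal (v / 2) A).
  by case: b.
by have [i4 e1 e2 e4] := HK _ mp lp.
Qed.

Section Family.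
Context {I : choiceType} (Z : I -> T -> R[i]) (v : I -> R).
Hypothesis v0 : forall i, 0 <= v i.
Hypothesis ZN : forall i, complex_normal P (v i) (Z i).
Hypothesis indZ : mutually_independent P Z.

Let mZ i : measurable_fun setT (complex_pair \o Z i). Proof. exact: (ZN i).1. Qed.

(* Independence on rectangles is extended first to events of the pair (Z j, Z k),
   then to events of the triple. *)
Lemma indep_three (i j k l : I) : uniq [:: i; j; k; l] ->
  indep_rv P (complex_pair \o Z i)
    (fun w => ((complex_pair (Z j w), complex_pair (Z k w)), complex_pair (Z l w))).
Proof.
move=> u A B mA mB.
pose Pr i A := P ((complex_pair \o Z i) @^-1` A).
have H4 := mutually_independent4 indZ u.
have mpre m (S : set (R * R)) : measurable S -> measurable ((complex_pair \o Z m) @^-1`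
    S).
  by move=> mS; rewrite -[X in measurable X]setTI; exact: mZ.
have T1 m : P ((complex_pair \o Z m) @^-1` setT) = 1%E.
  by rewrite preimage_setT probability_setT.
have jk A' C D : measurable A' -> measurable C -> measurable D ->
   P ((fun w => (complex_pair (Z j w), complex_pair (Z k w))) @^-1` C `&`
      ((complex_pair \o Z l) @^-1` D `&` (complex_pair \o Z i) @^-1` A')) =
   (P ((fun w => (complex_pair (Z j w), complex_pair (Z k w))) @^-1` C) *
    P ((complex_pair \o Z l) @^-1` D `&` (complex_pair \o Z i) @^-1` A'))%E.
  move=> mA' mC mD.
  apply: (@indep_rv_pair _ _ _ P _ _ _ _ (complex_pair \o Z j) (complex_pair \o Z k)) =>
      //.
    by apply: measurableI; apply: mpre.
  move=> A2 B2 mA2 mB2.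
  have := H4 A' A2 B2 D mA' mA2 mB2 mD.
  have := H4 setT A2 B2 setT measurableT mA2 mB2 measurableT.
  have := H4 A' setT setT D mA' measurableT measurableT mD.
  rewrite !T1 !preimage_setT !setTI !setIT !mule1 !mul1e => e1 e2 e3.
  rewrite [X in (_ * P X)%E]setIC e1 e2.
  rewrite setIA setIC !setIA -[LHS]/(P _).
  by rewrite e3 [RHS]muleACA [X in (_ = X * _)%E]muleC -[RHS]muleA.
rewrite setIC [in RHS]muleC.
apply: (@indep_rv_pair _ _ _ P _ _ _ _ (fun w => (complex_pair (Z j w),
    complex_pair (Z k w))) (complex_pair \o Z l)) => //.
- by apply: measurable_fun_pair; exact: mZ.
- exact: mpre.
move=> C D mC mD.
have e1 := jk A C D mA mC mD.
have e2 := jk setT C D measurableT mC mD.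
rewrite -setIA e1.
move: e2; rewrite preimage_setT setIT => ->.
have := H4 A setT setT D mA measurableT measurableT mD.
rewrite !T1 !preimage_setT !setIT !mul1e => e3.
by rewrite [X in (_ * P X)%E]setIC e3 -muleA [X in (_ * X)%E]muleC.
Qed.

(** The centred squares at different indices are functions of independent variables, hence
    uncorrelated. The limit is [w0 / 2] because each part carries half of the complex variance. *)
Lemma slln_part_square (b : bool) (i : nat -> I) (w0 : R) :
  injective i -> (forall n, v (i n) = w0) ->
  {ae P, forall w, (\sum_(0 <= a < n) complex_part b (Z (i a)) w ^+ 2) / n%:R @[n -->
      \oo] --> w0 / 2}.
Proof.
move=> inji vi.
have w00 : 0 <= w0 by rewrite -(vi 0%N).
have [K HK] := complex_part_moments w00.
pose G a := complex_part b (Z (i a)).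
have M a : [/\ L4 (G a), \int[P]_w G a w = 0,
      \int[P]_w (G a w ^+ 2) = w0 / 2 & \int[P]_w (G a w ^+ 4) = K].
  by apply: HK; rewrite -(vi a).
pose Y a w := G a w ^+ 2 - w0 / 2.
have Ecst (c : R) : \int[P]_(w in setT) c = c.
  apply: etrans (Rintegral_cst _ measurableT c) _.
  by rewrite [fine _](congr1 fine (probability_setT P)) mulr1.
have iG2 a : P.-integrable setT (EFin \o (fun w => G a w ^+ 2)).
  by have [/integrable_powers4[]] := M a.
have ic (c : R) : P.-integrable setT (EFin \o (fun _ : T =>
    c)) by exact: finite_measure_integrable_cst.
have iB (f g : T -> R) : P.-integrable setT (EFin \o f) ->
    P.-integrable setT (EFin \o g) ->
    P.-integrable setT (EFin \o (fun w => f w - g w)).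
  by move=> fi gi; exact: (integrableB measurableT fi gi).
have iD (f g : T -> R) : P.-integrable setT (EFin \o f) ->
    P.-integrable setT (EFin \o g) ->
    P.-integrable setT (EFin \o (fun w => f w + g w)).
  by move=> fi gi; exact: (integrableD measurableT fi gi).
have iZ (c : R) (f : T -> R) : P.-integrable setT (EFin \o f) ->
    P.-integrable setT (EFin \o (fun w => c * f w)).
  by move=> fi; exact: (integrableZl measurableT c fi).
have iY a : P.-integrable setT (EFin \o Y a) by apply: iB.
have iYY m n : P.-integrable setT (EFin \o (fun w => Y m w * Y n w)).
  have [Lm _ _ _] := M m; have [Ln _ _ _] := M n.
  have := iD _ _ (iB _ _ (integrable_mul4 Lm Lm Ln Ln) (iZ (w0 / 2) _ (iD _ _ (iG2 m)
      (iG2 n)))) (ic ((w0 / 2) ^+ 2)).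
  by apply: eq_integrable => // w _; rewrite /= /Y; congr EFin; ring.
have EY a : \int[P]_w Y a w = 0.
  rewrite /Y RintegralB//; have [_ _ -> _] := M a.
  by rewrite Ecst subrr.
have EY2 n : \int[P]_w (Y n w * Y n w) <= K + (w0 / 2) ^+ 2.
  have [[mn i4] _ E2 E4] := M n.
  under eq_Rintegral => w _.
    rewrite (_ : Y n w * Y n w = G n w ^+ 4 - w0 * G n w ^+ 2 + (w0 / 2) ^+ 2);
        last by rewrite /Y; field.
    over.
  rewrite RintegralD//; last by apply: iB => //; exact: iZ.
  rewrite RintegralB//; last exact: iZ.
  rewrite RintegralZl// E2 E4 Ecst.
  by rewrite lerD2r lerBlDr lerDl mulr_ge0// divr_ge0.
have E0 m n : m != n -> \int[P]_w (Y m w * Y n w) = 0.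
  move=> mn.
  have mf : measurable_fun setT (fun z : R * R => component b z ^+ 2 - w0 / 2).
    by apply: measurable_funB => //; apply: measurable_funX; exact: measurable_component.
  have -> := @product_expectation _ _ _ P _ _ _ _ (complex_pair \o Z (i m))
      (complex_pair \o Z (i n))
    (fun z : R * R => component b z ^+ 2 - w0 / 2) (fun z : R * R => component b z ^+
        2 - w0 / 2)
    (mZ _) (mZ _) (mutually_independent2 indZ _) mf mf (iY m) (iY n) (iYY m n).
    by rewrite [X in X * _](EY m) mul0r.
  by rewrite (inj_eq inji).
have := slln_uncorrelated iYY EY2 E0.
apply: filterS => w Hw.
have H2 : (\sum_(0 <= a < n) Y a w) / n%:R + w0 / 2 @[n --> \oo] --> 0 + w0 / 2.
  by apply: cvgD => //; exact: cvg_cst.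
rewrite add0r in H2; apply: cvg_trans H2; apply: near_eq_cvg.
(* At [n] = 0 the mean is 0 by convention and the centring term does not cancel, so the two
   sequences are compared from 1 on. *)
exists 1%N => // n /= n0.
have nn0 : n%:R != 0 :> R by rewrite pnatr_eq0 -lt0n.
rewrite /Y sumrB sumr_const_nat subn0 mulrBl -[w0 / 2 *+ n]mulr_natr mulfK// subrK//.
Qed.

(** For different antennas, one factor is independent of the triple formed by the other three and
    has mean 0, so the products are uncorrelated. *)
Lemma slln_part_cross (b c : bool) (i j : nat -> I) (v1 v2 : R) :
  injective i -> injective j -> (forall m n, i m != j n) ->
  (forall n, v (i n) = v1) -> (forall n, v (j n) = v2) ->
  {ae P, forall w, (\sum_(0 <= a < n) complex_part b (Z (i a)) w *
      complex_part c (Z (j a)) w) / n%:R @[n --> \oo] --> (0 : R)}.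
Proof.
move=> inji injj ij vi vj.
have v10 : 0 <= v1 by rewrite -(vi 0%N).
have v20 : 0 <= v2 by rewrite -(vj 0%N).
have [K1 H1] := complex_part_moments v10.
have [K2 H2] := complex_part_moments v20.
pose F a := complex_part b (Z (i a)); pose G a := complex_part c (Z (j a)).
have MF a : [/\ L4 (F a), \int[P]_w F a w = 0,
      \int[P]_w (F a w ^+ 2) = v1 / 2 & \int[P]_w (F a w ^+ 4) = K1].
  by apply: H1; rewrite -(vi a).
have MG a : [/\ L4 (G a), \int[P]_w G a w = 0,
      \int[P]_w (G a w ^+ 2) = v2 / 2 & \int[P]_w (G a w ^+ 4) = K2].
  by apply: H2; rewrite -(vj a).
pose Y a w := F a w * G a w.
have iYY m n : P.-integrable setT (EFin \o (fun w => Y m w * Y n w)).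
  have [Fm _ _ _] := MF m; have [Fn _ _ _] := MF n.
  have [Gm _ _ _] := MG m; have [Gn _ _ _] := MG n.
  have := integrable_mul4 Fm Gm Fn Gn.
  by apply: eq_integrable => // w _; rewrite /= /Y; congr EFin; ring.
have EY2 n : \int[P]_w (Y n w * Y n w) <= (v1 / 2) * (v2 / 2).
  have [/integrable_powers4[_ iF2] _ <- _] := MF n.
  have [/integrable_powers4[_ iG2] _ <- _] := MG n.
  have iFG : P.-integrable setT (EFin \o (fun w => F n w ^+ 2 * G n w ^+ 2)).
    by have := iYY n n; apply: eq_integrable => // w _; rewrite /= /Y; congr EFin; ring.
  rewrite (@eq_Rintegral _ _ _ P setT (fun w => F n w ^+ 2 * G n w ^+ 2)); last first.
    by move=> w _ /=; rewrite /Y; ring.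
  have mf e : measurable_fun setT (fun z : R * R => component e z ^+ 2).
    by apply: measurable_funX; exact: measurable_component.
  by rewrite (@product_expectation _ _ _ P _ _ _ _ (complex_pair \o Z (i n))
      (complex_pair \o Z (j n))
    (fun z : R * R => component b z ^+ 2) (fun z : R * R => component c z ^+ 2)
    (mZ _) (mZ _) (mutually_independent2 indZ (ij n n)) (mf b) (mf c) iF2 iG2 iFG).
have E0 m n : m != n -> \int[P]_w (Y m w * Y n w) = 0.
  move=> mn.
  (* Disjoint ranges of [i] and [j], injectivity and [m] != [n] make the four indices distinct, as
     [indep_three] requires. *)
  have u : uniq [:: i m; i n; j m; j n].
    by rewrite /= !inE !negb_or !ij (inj_eq inji) (inj_eq injj) mn.
  have [Fm Em _ _] := MF m; have [Fn _ _ _] := MF n.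
  have [Gm _ _ _] := MG m; have [Gn _ _ _] := MG n.
  pose W w := (complex_pair (Z (i n) w), complex_pair (Z (j m) w),
      complex_pair (Z (j n) w)).
  have mW : measurable_fun setT W.
    by apply: measurable_fun_pair; [apply: measurable_fun_pair|]; exact: mZ.
  pose g (z : (R * R) * (R * R) * (R * R)) := component b z.1.1 * component c z.1.2 *
      component c z.2.
  have mg : measurable_fun setT g.
    apply: measurable_funM; last exact: (measurableT_comp (measurable_component c)
        measurable_snd).
    apply: measurable_funM.
      exact: (measurableT_comp (measurable_component b) (measurableT_comp measurable_fst
          measurable_fst)).
    exact: (measurableT_comp (measurable_component c) (measurableT_comp measurable_snd
        measurable_fst)).
  have L1 : L4 (fun=> 1) .
    by split => //; under eq_fun do rewrite expr1n; exact: finite_measure_integrable_cst.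
  have ig : P.-integrable setT (EFin \o (g \o W)).
    have := integrable_mul4 Fn Gm Gn L1.
    by apply: eq_integrable => // w _; rewrite /= mulr1.
  have ifg : P.-integrable setT (EFin \o (fun w => component b (complex_pair (Z (i m)
      w)) * g (W w))).
    have := iYY m n.
    by apply: eq_integrable => // w _; rewrite /= /Y /F /G /complex_part /g /=;
        congr EFin; ring.
  have [iF _] := integrable_powers4 Fm.
  rewrite (@eq_Rintegral _ _ _ P setT (fun w => component b (complex_pair (Z (i m) w)) *
      g (W w))); last first.
    by move=> w _ /=; rewrite /Y /F /G /complex_part /g /=; ring.
  rewrite (@product_expectation _ _ _ P _ _ _ _ (complex_pair \o Z (i m)) W
    (component b) g (mZ _) mW (indep_three u) (measurable_component b) mg iF ig ifg).
  by rewrite [X in X * _]Em mul0r.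
exact: (slln_uncorrelated iYY EY2 E0).
Qed.

End Family.

End TapLimits.

(** * Limits of the precoded signal *)

Section ComplexLimits.
Context {R : realType}.

Lemma sqrtC_real (x : R) : 0 <= x -> sqrtC (x%:C : R[i]) = (Num.sqrt x)%:C.
Proof.
move=> x0; have -> : x%:C = (Num.sqrt x)%:C ^+ 2 :> R[i].
  by rewrite -rmorphXn /= sqr_sqrtr.
by rewrite sqrCK// lecR sqrtr_ge0.
Qed.

Lemma cvg_real_complex (u : nat -> R) (l : R) :
  u n @[n --> \oo] --> l -> (u n)%:C @[n --> \oo] --> (l%:C : R[i]^o).
Proof.
move=> ul; apply/(@cvgrPdist_lt R[i] R[i]^o) => e e0.
(* In the partial order of [R[i]] a positive element is real, so a complex tolerance reduces to a
   real one. *)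
have eE : e = (complex.Re e)%:C by case: e e0 => a b; rewrite ltcE/= => /andP[/eqP -> _].
have e0' : 0 < complex.Re e by move: e0; rewrite eE ltcR.
move/cvgrPdist_lt : ul => /(_ _ e0'); apply: filterS => n h.
by rewrite eE -rmorphB normc_def /= expr0n addr0 sqrtr_sqr ltcR.
Qed.

Lemma ccvg_cst (a : R[i]) : a @[n --> \oo] --> (a : R[i]^o).
Proof. exact: (@cvg_cst R[i]^o). Qed.

Lemma ccvgD (u v : nat -> R[i]) (a b : R[i]) :
  u n @[n --> \oo] --> (a : R[i]^o) -> v n @[n --> \oo] --> (b : R[i]^o) ->
  u n + v n @[n --> \oo] --> (a + b : R[i]^o).
Proof. by move=> ua vb; exact: (@cvgD R[i] R[i]^o nat \oo _ u v a b ua vb). Qed.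

Lemma ccvgM (u v : nat -> R[i]) (a b : R[i]) :
  u n @[n --> \oo] --> (a : R[i]^o) -> v n @[n --> \oo] --> (b : R[i]^o) ->
  u n * v n @[n --> \oo] --> (a * b : R[i]^o).
Proof. by move=> ua vb; exact: (@cvgM R[i] nat \oo _ u v a b ua vb). Qed.

Lemma ccvgZ (c : R[i]) (v : nat -> R[i]) (b : R[i]) :
  v n @[n --> \oo] --> (b : R[i]^o) -> c * v n @[n --> \oo] --> (c * b : R[i]^o).
Proof. exact: (ccvgM (@ccvg_cst c)). Qed.

Lemma ccvgV (u : nat -> R[i]) (a : R[i]) : a != 0 ->
  u n @[n --> \oo] --> (a : R[i]^o) -> (u n)^-1 @[n --> \oo] --> (a^-1 : R[i]^o).
Proof. by move=> a0 ua; exact: (@cvgV R[i] nat \oo _ u a a0 ua). Qed.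

Lemma cvg_complex (u : nat -> R[i]) (l : R[i]) :
  complex.Re (u n) @[n --> \oo] --> complex.Re l ->
  complex.Im (u n) @[n --> \oo] --> complex.Im l ->
  u n @[n --> \oo] --> (l : R[i]^o).
Proof.
move=> h1 h2; rewrite [l]complexE.
have -> : u = (fun n => (complex.Re (u n))%:C + 'i%C * (complex.Im (u n))%:C).
  by apply/funext => n; rewrite [LHS]complexE.
exact: (ccvgD (cvg_real_complex h1) (ccvgM (@ccvg_cst 'i%C) (cvg_real_complex h2))).
Qed.

Lemma cvg_Re (u : nat -> R[i]) (l : R[i]) :
  u n @[n --> \oo] --> (l : R[i]^o) ->
  complex.Re (u n) @[n --> \oo] --> complex.Re l.
Proof.
move=> /(@cvgrPdist_lt R[i] R[i]^o) ul; apply/cvgrPdist_lt => e e0.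
have e0' : 0 < e%:C :> R[i] by rewrite ltcR.
move: (ul _ e0'); apply: filterS => n /(le_lt_trans (normc_ge_Re _)).
by rewrite ltcR raddfB.
Qed.

Lemma cvg_bigsum (I : Type) (r : seq I) (Q : pred I) (u : I -> nat -> R[i]) (l : I ->
    R[i]) :
  (forall i, Q i -> u i n @[n --> \oo] --> (l i : R[i]^o)) ->
  \sum_(i <- r | Q i) u i n @[n --> \oo] --> (\sum_(i <- r | Q i) l i : R[i]^o).
Proof.
move=> ul; elim: r => [|i r IH].
  by rewrite big_nil; under eq_fun do rewrite big_nil; exact: ccvg_cst.
rewrite big_cons; under eq_fun do rewrite big_cons.
case: ifPn => Qi; last exact: IH.
exact: (ccvgD (ul i Qi) IH).
Qed.

Lemma sqrtC_nat (n : nat) : sqrtC (n%:R : R[i]) = (Num.sqrt (n%:R : R))%:C.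
Proof. by rewrite -sqrtC_real// rmorph_nat. Qed.

Lemma cvg_div_sqrt (z : R[i]) : z / sqrtC n%:R @[n --> \oo] --> (0 : R[i]^o).
Proof.
suff H : (sqrtC n%:R)^-1 @[n --> \oo] --> (0 : R[i]^o).
  by rewrite -(mulr0 z); exact: (ccvgM (@ccvg_cst z) H).
have -> : (fun n => (sqrtC n%:R)^-1 : R[i]) = (fun n => (Num.sqrt (n%:R^-1 : R))%:C).
  by apply/funext => n; rewrite sqrtC_nat sqrtrV// fmorphV.
suff H : Num.sqrt (n%:R^-1 : R) @[n --> \oo] --> Num.sqrt (0 : R).
  by move: (cvg_real_complex H); rewrite sqrtr0.
 apply: continuous_cvg; first exact: sqrt_continuous.
rewrite -cvg_shiftS; exact: cvg_harmonic.
Qed.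

End ComplexLimits.

(** * Roots of unity *)

Section Twiddle.
Context {R : realType} (Nfft : nat).
Hypothesis Nfft_gt0 : (0 < Nfft)%N.

Local Notation tw := (@twiddle R Nfft).

Lemma twiddleD (a b : int) : tw (a + b) = tw a * tw b.
Proof.
rewrite /twiddle rmorphD /= mulrDr mulrDl cosD sinD.
apply/eqP; rewrite eq_complex /=; apply/andP; split; apply/eqP; ring.
Qed.

Lemma twiddle0 : tw 0 = 1.
Proof. by rewrite /twiddle mulr0 mul0r cos0 sin0. Qed.

Lemma twiddleN (a : int) : tw (- a) = Num.conj (tw a).
Proof. by rewrite /twiddle rmorphN /= mulrN mulNr cosN sinN. Qed.

Lemma twiddle_period (k : nat) (a : int) : tw (a + k%:Z * Nfft%:Z) = tw a.
Proof.
elim: k => [|k IH]; first by rewrite mul0r addr0.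
rewrite -[k.+1]addn1 PoszD mulrDl mul1r addrA twiddleD IH.
rewrite (_ : tw Nfft%:Z = 1) ?mulr1//.
rewrite /twiddle -pmulrn mulfK; last by rewrite pnatr_eq0 -lt0n.
by rewrite mulrC mulr_natr cos2pi sin2pi.
Qed.

Lemma twiddle_norm (a : int) : tw a * Num.conj (tw a) = 1.
Proof. by rewrite -twiddleN -twiddleD subrr twiddle0. Qed.

End Twiddle.

(** * Reduction of the signal at one sample to the unique block containing it *)

Section Ofdm.
Context {R : realType} (Nfft Nsc Ncp : nat).
Hypothesis Nfft_gt0 : (0 < Nfft)%N.

Lemma fsbig_single (V : nmodType) (F : int -> V) (b : int) :
  (forall c, c != b -> F c = 0) -> \sum_(c \in [set: int]) F c = F b.
Proof.
move=> F0.
rewrite -(fsbig_widen [set b] setT) ?fsbig_set1// => c [_ /= cb].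
by apply: F0; apply/eqP.
Qed.

Lemma in_block_unique (b c j : int) : in_block Nfft Ncp j -> c != b ->
  in_block Nfft Ncp (b * (Ncp + Nfft)%N%:Z + j - c * (Ncp + Nfft)%N%:Z) = false.
Proof.
rewrite /in_block => jb cb; apply/negP => hb.
move/eqP: cb; apply.
have [h|h|//] := ltgtP c b; nia.
Qed.

Lemma ofdm_vecE (Nt : nat) (w : 'I_Nsc -> 'cV[R[i]]_Nt) (x : int -> 'I_Nsc ->
    R[i]) (b j : int) :
  in_block Nfft Ncp j ->
  ofdm_vec Nfft Ncp w x (b * (Ncp + Nfft)%N%:Z + j) = ofdm_block_vec Nfft Ncp w x b j.
Proof.
move=> jb; rewrite /ofdm_vec (@fsbig_single _ _ b); last first.
  by move=> c cb; rewrite /ofdm_block_vec in_block_unique.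
by rewrite addrAC subrr add0r.
Qed.

Lemma ofdmE (x : int -> 'I_Nsc -> R[i]) (b j : int) :
  in_block Nfft Ncp j ->
  ofdm Nfft Ncp x (b * (Ncp + Nfft)%N%:Z + j) = ofdm_block Nfft Ncp x b j.
Proof.
move=> jb; rewrite /ofdm (@fsbig_single _ _ b); last first.
  by move=> c cb; rewrite /ofdm_block in_block_unique.
by rewrite addrAC subrr add0r.
Qed.

End Ofdm.

(** * Limit of the received signal for one fixed realisation of channel, symbols and noise *)

Section MrtLimit.
Context {R : realType} (Nfft Nsc Ncp L : nat).
Hypothesis Nfft_gt0 : (0 < Nfft)%N.
Hypothesis L_le : (L <= Nfft)%N.
Variables (E : 'I_L -> R) (H : 'I_L -> nat -> R[i]).
Hypothesis E_ge0 : forall p, 0 <= E p.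
Hypothesis alpha_gt0 : 0 < alphaL E.

Let S (p q : 'I_L) (n : nat) : R[i] := \sum_(a < n) H p a * Num.conj (H q a).

Hypothesis Hlim : forall p q,
  S p q n / n%:R @[n --> \oo] --> (((if p == q then E p else 0)%:C) : R[i]^o).

Local Notation tw := (@twiddle R Nfft).
Local Notation alpha := (alphaL E).

Lemma alphaL_sqr : alpha ^+ 2 = \sum_(p < L) E p.
Proof. by rewrite /alphaL sqr_sqrtr// sumr_ge0. Qed.

Lemma freq_responseE n l a :
  freq_response Nfft H n l a 0 = \sum_(p < L) tw (- (l%:Z * p%:Z)) * H p a.
Proof. by rewrite /freq_response summxE; apply: eq_bigr => p _; rewrite !mxE. Qed.

Lemma freq_energyE n l :
  \sum_a `|freq_response Nfft H n l a 0| ^+ 2 =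
  \sum_(p < L) \sum_(q < L) (tw (- (l%:Z * p%:Z)) * Num.conj (tw (- (l%:Z * q%:Z)))) *
      S p q n.
Proof.
under eq_bigr do rewrite normCK freq_responseE rmorph_sum big_distrlr /=.
rewrite exchange_big /=; apply: eq_bigr => p _.
rewrite exchange_big /=; apply: eq_bigr => q _.
rewrite /S big_distrr /=; apply: eq_bigr => a _.
by rewrite rmorphM /= mulrACA.
Qed.

(** Only the terms [p] = [q] survive in the limit, and there the two phases cancel. The normalised
    channel energy is therefore the same on every subcarrier. *)
Lemma cvg_freq_energy l :
  (\sum_a `|freq_response Nfft H n l a 0| ^+ 2) / n%:R @[n --> \oo] -->
    ((alpha ^+ 2)%:C : R[i]^o).
Proof.
rewrite alphaL_sqr rmorph_sum /=.
have -> : (fun n => (\sum_a `|freq_response Nfft H n l a 0| ^+ 2) / n%:R) =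
  (fun n => \sum_(p < L) \sum_(q < L) (tw (- (l%:Z * p%:Z)) * Num.conj (tw (- (l%:Z *
      q%:Z)))) * (S p q n / n%:R)).
  apply/funext => n; rewrite freq_energyE mulr_suml; apply: eq_bigr => p _.
  by rewrite mulr_suml; apply: eq_bigr => q _; rewrite mulrA.
apply: cvg_bigsum => p _.
have -> : (E p)%:C = \sum_(q < L) (tw (- (l%:Z * p%:Z)) * Num.conj (tw (- (l%:Z *
    q%:Z)))) * (if p == q then E p else 0)%:C.
  rewrite (bigD1 p)//= eqxx twiddle_norm mul1r big1 ?addr0// => q qp.
  by rewrite eq_sym (negbTE qp) mulr0.
by apply: cvg_bigsum => q _; apply: ccvgZ; exact: Hlim.
Qed.

Lemma cvg_l2norm l :
  l2norm (freq_response Nfft H n l) / sqrtC n%:R @[n --> \oo] --> (alpha%:C : R[i]^o).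
Proof.
pose e n := \sum_a `|freq_response Nfft H n l a 0| ^+ 2.
pose x n := complex.Re (e n).
have e0 n : 0 <= e n by rewrite sumr_ge0// => a _; rewrite exprn_ge0.
have eE n : e n = (x n)%:C by rewrite /x RRe_real// ger0_real.
have x0 n : 0 <= x n by rewrite -lecR -eE.
have xl : x n / n%:R @[n --> \oo] --> alpha ^+ 2.
  have := cvg_Re (cvg_freq_energy l).
  have -> // : (fun n => complex.Re (e n / n%:R)) = (fun n => x n / n%:R).
  by apply/funext => n; rewrite eE -(rmorph_nat (real_complex R)) -fmorphV -rmorphM.
have sl : Num.sqrt (x n / n%:R) @[n --> \oo] --> alpha.
  have -> : alpha = Num.sqrt (alpha ^+ 2) by rewrite sqrtr_sqr gtr0_norm.
  by apply: continuous_cvg xl; exact: sqrt_continuous.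
have := cvg_real_complex sl.
have -> // : (fun n => (Num.sqrt (x n / n%:R))%:C) =
  (fun n => l2norm (freq_response Nfft H n l) / sqrtC n%:R).
apply/funext => n; rewrite /l2norm -/(e n) eE sqrtC_real// sqrtC_nat.
by rewrite -fmorphV -rmorphM sqrtrM// sqrtrV.
Qed.

Lemma mrt_gainE n (m : 'I_L) (l : 'I_Nsc) :
  ((tap_vec H n m)^T *m mrt_precoder Nfft H n l) 0 0 =
  (l2norm (freq_response Nfft H n l))^-1 * \sum_(p < L) tw (l%:Z * p%:Z) * S m p n.
Proof.
rewrite /mrt_precoder -scalemxAr mxE; congr (_ * _); rewrite mxE.
under eq_bigr do rewrite !mxE freq_responseE rmorph_sum mulr_sumr /=.
rewrite exchange_big; apply: eq_bigr => p _.
rewrite /S mulr_sumr; apply: eq_bigr => a _.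
by rewrite rmorphM /= twiddleN conjCK mulrCA.
Qed.

(** The gain over sqrt n is (sqrt n / norm) times the mean correlations. The first factor tends to 1
    / alpha, and among the correlations only [p] = [m] survives, with the conjugated, hence
    positive, phase. *)
Lemma cvg_mrt_gain (m : 'I_L) (l : 'I_Nsc) :
  ((tap_vec H n m)^T *m mrt_precoder Nfft H n l) 0 0 / sqrtC n%:R @[n --> \oo] -->
    ((E m / alpha)%:C * tw (l%:Z * m%:Z) : R[i]^o).
Proof.
have a0 : alpha%:C != 0 :> R[i] by rewrite fmorph_eq0 gt_eqF.
have H1 : \sum_(p < L) tw (l%:Z * p%:Z) * (S m p n / n%:R) @[n --> \oo] --> ((E m)%:C *
    tw (l%:Z * m%:Z) : R[i]^o).
  have -> : (E m)%:C * tw (l%:Z * m%:Z) = \sum_(p < L) tw (l%:Z * p%:Z) * (if m ==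
      p then E m else 0)%:C.
    rewrite (bigD1 m)//= eqxx mulrC big1 ?addr0// => p pm.
    by rewrite eq_sym (negbTE pm) mulr0.
  by apply: cvg_bigsum => p _; apply: ccvgZ; exact: Hlim.
have := ccvgM (ccvgV a0 (cvg_l2norm l)) H1.
rewrite mulrA -fmorphV -rmorphM (mulrC alpha^-1); apply: cvg_trans.
apply: near_eq_cvg; exists 1%N => // n /= n0.
rewrite mrt_gainE; under eq_bigr do rewrite mulrA.
rewrite -mulr_suml invf_div.
have sn0 : sqrtC n%:R != 0 :> R[i] by rewrite sqrtC_eq0 pnatr_eq0 -lt0n.
rewrite -[X in (X / _) * _]/(_) -{2}(sqrtCK n%:R) expr2 invfM.
rewrite mulrACA -[RHS]mulrA [X in _ = _ * X]mulrC.
move: (l2norm _)^-1 (\sum_(p < L) _) => i Q.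
by field.
Qed.

Variable x : int -> 'I_Nsc -> R[i].

(** The phase l m of the precoder adds to l j, which advances the waveform by [m]. The sum stays
    explicit because j + m may lie beyond the block, where [ofdm_block] is 0. *)
Lemma cvg_tap_block (m : 'I_L) (b j : int) : in_block Nfft Ncp j ->
  ((tap_vec H n m)^T *m ofdm_block_vec Nfft Ncp (mrt_precoder Nfft H n) x b j) 0 0
    / sqrtC n%:R @[n --> \oo] -->
  ((E m / alpha)%:C * ((sqrtC Nsc%:R)^-1 *
     \sum_(l < Nsc) x b l * tw (l%:Z * (j + m%:Z))) : R[i]^o).
Proof.
move=> jb.
have -> : (fun n => ((tap_vec H n m)^T *m ofdm_block_vec Nfft Ncp (mrt_precoder Nfft H
    n) x b j) 0 0
    / sqrtC n%:R) = (fun n => (sqrtC Nsc%:R)^-1 * \sum_(l < Nsc) x b l * tw (l%:Z * j) *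
      (((tap_vec H n m)^T *m mrt_precoder Nfft H n l) 0 0 / sqrtC n%:R)).
  apply/funext => n; rewrite /ofdm_block_vec jb -scalemxAr mxE -mulrA; congr (_ * _).
  rewrite mulmx_sumr summxE mulr_suml; apply: eq_bigr => l _.
  by rewrite -scalemxAr mxE mulrA.
rewrite mulrCA; apply: ccvgZ; rewrite mulr_sumr.
apply: cvg_bigsum => l _.
have -> : (E m / alpha)%:C * (x b l * tw (l%:Z * (j + m%:Z))) =
    x b l * tw (l%:Z * j) * ((E m / alpha)%:C * tw (l%:Z * m%:Z)).
  by rewrite mulrDr twiddleD; ring.
by apply: ccvgZ; exact: cvg_mrt_gain.
Qed.

Lemma cvg_tap_received (k : int) (m : 'I_L) : in_block Nfft Ncp k ->
  ((tap_vec H n m)^T *m ofdm_vec Nfft Ncp (mrt_precoder Nfft H n) x (k - m%:Z)) 0 0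
    / sqrtC n%:R @[n --> \oo] -->
  ((E m / alpha)%:C * (if (m%:Z <= k + Ncp%:Z)%R then ofdm Nfft Ncp x k
                       else ofdm Nfft Ncp x (k - Nfft%:Z)) : R[i]^o).
Proof.
move=> kb; have := ltn_ord m; move: (kb); rewrite /in_block => kb' mL.
case: ifPn => mk.
  have jb : in_block Nfft Ncp (k - m%:Z) by rewrite /in_block; lia.
  have -> : k - m%:Z = 0 * (Ncp + Nfft)%N%:Z + (k - m%:Z) by rewrite mul0r add0r.
  under eq_fun do rewrite ofdm_vecE//.
  have := @cvg_tap_block m 0 _ jb.
  by rewrite subrK -[X in ofdm _ _ _ X]add0r -(mul0r (Ncp +
      Nfft)%N%:Z) ofdmE// /ofdm_block kb.
(* Here k - m precedes the current block and lies in block -1. The advanced index k + Ncp + Nfft is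
   one period past k + Ncp, and local index k + Ncp of block -1 is the global sample k - Nfft. Both
   indices lie in the block because m <= L - 1 <= Nfft - 1. *)
have jb : in_block Nfft Ncp (k - m%:Z + (Ncp + Nfft)%N%:Z) by rewrite /in_block; lia.
have jb2 : in_block Nfft Ncp (k + Ncp%:Z) by rewrite /in_block; lia.
have -> : k - m%:Z = (-1) * (Ncp + Nfft)%N%:Z + (k - m%:Z + (Ncp + Nfft)%N%:Z) by lia.
under eq_fun do rewrite ofdm_vecE//.
have -> : k - Nfft%:Z = (-1) * (Ncp + Nfft)%N%:Z + (k + Ncp%:Z) by lia.
rewrite ofdmE// /ofdm_block jb2.
have := @cvg_tap_block m (-1) _ jb.
under eq_bigr => l _.
  have -> : l%:Z * (k - m%:Z + (Ncp + Nfft)%N%:Z + m%:Z) = l%:Z * (k + Ncp%:Z) + l%:Z *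
      Nfft%:Z by lia.
  rewrite twiddle_period//.
  over.
exact.
Qed.

Lemma cvg_received (z : int -> R[i]) (k : int) : in_block Nfft Ncp k ->
  received Nfft Ncp H x z (mrt_precoder Nfft H n) k / sqrtC n%:R @[n --> \oo] -->
    ((beta2 Ncp E k / alpha)%:C * ofdm Nfft Ncp x k +
     ((alpha ^+ 2 - beta2 Ncp E k) / alpha)%:C * ofdm Nfft Ncp x (k - Nfft%:Z) : R[i]^o).
Proof.
move=> kb; rewrite /received.
have -> : (fun n => (\sum_(m < L) ((tap_vec H n m)^T *m ofdm_vec Nfft Ncp (mrt_precoder
    Nfft H n) x (k - m%:Z)) 0 0 + z k) / sqrtC n%:R) =
  (fun n => \sum_(m < L) (((tap_vec H n m)^T *m ofdm_vec Nfft Ncp (mrt_precoder Nfft H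
      n) x (k - m%:Z)) 0 0 / sqrtC n%:R) + z k / sqrtC n%:R).
  by apply/funext => n; rewrite mulrDl mulr_suml.
set rhs := (X in _ --> X).
have -> : rhs = \sum_(m < L) (E m / alpha)%:C * (if (m%:Z <= k +
    Ncp%:Z)%R then ofdm Nfft Ncp x k
                       else ofdm Nfft Ncp x (k - Nfft%:Z)) + 0.
  (* The taps split by the block they see: those with m <= k + Ncp sum to beta_k^2, the others to
     the remainder of alpha^2. *)
  rewrite addr0 (bigID (fun m : 'I_L => (m%:Z <= k + Ncp%:Z)%R)) /=.
  have bE : beta2 Ncp E k = \sum_(m < L | (m%:Z <= k + Ncp%:Z)%R) E m.
    by apply: eq_bigl => m; have := ltn_ord m; lia.
  have aE : alpha ^+ 2 - beta2 Ncp E k = \sum_(m < L | ~~ (m%:Z <= k + Ncp%:Z)%R) E m.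
    by rewrite alphaL_sqr (bigID (fun m : 'I_L => (m%:Z <= k + Ncp%:Z)%R)) /=
        bE addrAC subrr add0r.
  rewrite /rhs aE bE !mulr_suml !rmorph_sum /= !mulr_suml.
  congr (_ + _); apply: eq_bigr => m mk; first by rewrite mk.
  by rewrite (negbTE mk).
apply: ccvgD; last exact: cvg_div_sqrt.
by apply: cvg_bigsum => m _; exact: cvg_tap_received.
Qed.

End MrtLimit.

(** * Almost sure correlations of the taps *)

Section TapCorrelation.
Context {R : realType} {d : measure_display} {T : measurableType d}.
Variable P : probability T R.
Variables (L : nat) (E : 'I_L -> R) (h : 'I_L -> nat -> T -> R[i]).
Hypothesis E_ge0 : forall p, 0 <= E p.
Hypothesis h_normal : forall p a, complex_normal P (E p) (h p a).
Hypothesis h_indep : mutually_independent P (fun pa : 'I_L * nat => h pa.1 pa.2).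

Let Z (pa : 'I_L * nat) := h pa.1 pa.2.
Let v (pa : 'I_L * nat) := E pa.1.
Let v0 pa : 0 <= v pa. Proof. exact: E_ge0. Qed.
Let ZN pa : complex_normal P (v pa) (Z pa). Proof. exact: h_normal. Qed.

Lemma mulr_conjE (a b : R[i]) : a * Num.conj b =
  (complex.Re a * complex.Re b + complex.Im a * complex.Im b) +i*
  (complex.Im a * complex.Re b - complex.Re a * complex.Im b).
Proof.
case: a b => [a1 a2] [b1 b2]; apply/eqP; rewrite eq_complex /=.
by apply/andP; split; apply/eqP; ring.
Qed.

Lemma tap_correlation (p q : 'I_L) :
  {ae P, forall w, (\sum_(a < n) h p a w * Num.conj (h q a w)) / n%:R @[n --> \oo] -->
    ((if p == q then E p else 0)%:C : R[i]^o)}.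
Proof.
have ReE (u : nat -> R[i]) n : complex.Re ((\sum_(a < n) u a) / n%:R) =
    (\sum_(0 <= a < n) complex.Re (u a)) / n%:R.
  rewrite big_mkord -(rmorph_nat (real_complex R)) -fmorphV mulrC.
  by rewrite -raddf_sum; case: (\sum_(i < n) _) => a b /=; rewrite mul0r subr0 mulrC.
have ImE (u : nat -> R[i]) n : complex.Im ((\sum_(a < n) u a) / n%:R) =
    (\sum_(0 <= a < n) complex.Im (u a)) / n%:R.
  rewrite big_mkord -(rmorph_nat (real_complex R)) -fmorphV mulrC.
  by rewrite -raddf_sum; case: (\sum_(i < n) _) => a b /=; rewrite mul0r addr0 mulrC.
have inj r : injective (fun n : nat => (r, n) : 'I_L * nat) by move=> m n [].
have vE r n : v (r, n) = E r by [].
(* On the diagonal the imaginary part vanishes identically and the real part is a sum of two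
   squares. Off the diagonal both parts are combinations of cross products from disjoint index
   sets. *)
have [<-|pq] := eqVneq p q.
  have H b := slln_part_square v0 ZN h_indep b (inj p) (vE p).
  move: (H true) (H false); apply: filterS2 => w H1 H2.
  apply: cvg_complex.
    rewrite (funext (ReE (fun a => h p a w * Num.conj (h p a w)))) [complex.Re
        (real_complex _ _)]/=.
    have -> : E p = E p / 2 + E p / 2 by field.
    have -> : (fun n => (\sum_(0 <= a < n) complex.Re (h p a w *
        Num.conj (h p a w))) / n%:R) =
      (fun n => (\sum_(0 <= a < n) complex_part true (Z (p, a)) w ^+ 2) / n%:R +
                (\sum_(0 <= a < n) complex_part false (Z (p, a)) w ^+ 2) / n%:R).
      apply/funext => n; rewrite -mulrDl -big_split /=; congr (_ / _).
      by apply: eq_bigr => a _; rewrite mulr_conjE.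
    exact: cvgD H1 H2.
  rewrite (funext (ImE (fun a => h p a w * Num.conj (h p a w)))) [complex.Im
      (real_complex _ _)]/=.
  apply: cvg_near_cst; apply: nearW => n.
  rewrite big1 ?mul0r// => a _; rewrite mulr_conjE /=; ring.
have pqE m n : (p, m) != (q, n) :> 'I_L * nat by rewrite xpair_eqE (negbTE pq).
have H b c := slln_part_cross v0 ZN h_indep b c (inj p) (inj q) pqE (vE p) (vE q).
have HRe : {ae P, forall w, complex.Re ((\sum_(a < n) h p a w *
    Num.conj (h q a w)) / n%:R) @[n --> \oo] --> (0 : R)}.
  move: (H true true) (H false false); apply: filterS2 => w H1 H2.
  rewrite (funext (ReE (fun a => h p a w * Num.conj (h q a w)))).
  have -> : (fun n => (\sum_(0 <= a < n) complex.Re (h p a w *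
      Num.conj (h q a w))) / n%:R) =
    (fun n => (\sum_(0 <= a < n) complex_part true (Z (p,
        a)) w * complex_part true (Z (q, a)) w) / n%:R +
              (\sum_(0 <= a < n) complex_part false (Z (p,
                  a)) w * complex_part false (Z (q, a)) w) / n%:R).
    apply/funext => n; rewrite -mulrDl -big_split /=; congr (_ / _).
    by apply: eq_bigr => a _; rewrite mulr_conjE.
  by rewrite -[X in _ --> X]addr0; exact: cvgD H1 H2.
have HIm : {ae P, forall w, complex.Im ((\sum_(a < n) h p a w *
    Num.conj (h q a w)) / n%:R) @[n --> \oo] --> (0 : R)}.
  move: (H false true) (H true false); apply: filterS2 => w H1 H2.
  rewrite (funext (ImE (fun a => h p a w * Num.conj (h q a w)))).
  have -> : (fun n => (\sum_(0 <= a < n) complex.Im (h p a w *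
      Num.conj (h q a w))) / n%:R) =
    (fun n => (\sum_(0 <= a < n) complex_part false (Z (p,
        a)) w * complex_part true (Z (q, a)) w) / n%:R -
              (\sum_(0 <= a < n) complex_part true (Z (p,
                  a)) w * complex_part false (Z (q, a)) w) / n%:R).
    apply/funext => n; rewrite -mulrBl -sumrB; congr (_ / _).
    by apply: eq_bigr => a _; rewrite mulr_conjE.
  by rewrite -[X in _ --> X](subr0 0); exact: cvgB H1 H2.
by move: HRe HIm; apply: filterS2 => w HR HI; exact: cvg_complex.
Qed.

End TapCorrelation.

(** * Two blocks of independent symbols do not almost surely carry the same sample *)

Section SymbolSeparation.
Context {R : realType} {d : measure_display} {T : measurableType d}.
Variable P : probability T R.

Definition box (a b c e : R) : set (R * R) := `]a, b[%classic `*` `]c, e[%classic.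

Lemma measurable_box a b c e : measurable (box a b c e).
Proof. by apply: measurableX; exact: measurable_itv. Qed.

Lemma complex_normal_box_gt0 (v a b c e : R) (Z : T -> R[i]) :
  0 < v -> a < b -> c < e -> complex_normal P v Z ->
  (0 < P ((complex_pair \o Z) @^-1` box a b c e))%E.
Proof.
move=> v0 ab ce [mZ law]; rewrite law; [|exact: measurable_itv..].
have v20 : 0 < v / 2 by rewrite divr_gt0.
have s0 : Num.sqrt (v / 2) != 0 by rewrite sqrtr_eq0 -ltNge.
by rewrite /centered_normal gt_eqF// mule_gt0// normal_prob_itv_gt0.
Qed.

Lemma independent_boxes_gt0 (I : choiceType) (Z : I -> T -> R[i]) (J : seq I)
    (A : I -> set (R * R)) :
  mutually_independent P Z -> uniq J -> (forall i, measurable (A i)) ->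
  (forall i, (0 < P ((complex_pair \o Z i) @^-1` A i))%E) ->
  (0 < P (\bigcap_(i in [set` J]) (complex_pair \o Z i) @^-1` A i))%E.
Proof.
move=> indZ uJ mA PA; rewrite indZ//.
elim: J {uJ} => [|i J IH]; first by rewrite big_nil lte01.
by rewrite big_cons mule_gt0.
Qed.

Lemma norm_complex_le (z : R[i]) : `|z| <= (`|complex.Re z| + `|complex.Im z|)%:C.
Proof.
rewrite normc_def lecR -(@ler_pXn2r _ 2) ?nnegrE ?addr_ge0 ?sqrtr_ge0//.
rewrite sqr_sqrtr ?addr_ge0 ?sqr_ge0// sqrrD !real_normK ?num_real//.
by rewrite addrAC lerDl mulrn_wge0// mulr_ge0.
Qed.

(* On an event of positive probability one symbol exceeds the sum of the norms of
   all the others. *)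
Lemma symbols_separated (Nsc : nat) (v : R) (x : int -> 'I_Nsc -> T -> R[i])
    (c0 c1 : 'I_Nsc -> R[i]) (b0 b1 : int) :
  (0 < Nsc)%N -> 0 < v -> b0 != b1 ->
  (forall l, `|c0 l| = 1) -> (forall l, `|c1 l| = 1) ->
  iid_complex_normal P v (fun bl : int * 'I_Nsc => x bl.1 bl.2) ->
  ~ {ae P, forall w, \sum_l x b0 l w * c0 l = \sum_l x b1 l w * c1 l}.
Proof.
move=> N0 v0 b01 n0 n1 [xN xI] [N [mN PN0 subN]].
pose Z (bl : int * 'I_Nsc) := x bl.1 bl.2.
pose l0 : 'I_Nsc := Ordinal N0.
(* Every other symbol has real and imaginary parts in ]-1, 1[, hence norm at most 2; two blocks
   contribute at most 2 Nsc each. *)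
pose M : R := (4 * Nsc)%:R.
pose A (i : int * 'I_Nsc) := if i == (b0, l0) then box M (M +
    1) (-1) 1 else box (-1) 1 (-1) 1.
pose J := [seq (b0, l) | l <- enum 'I_Nsc] ++ [seq (b1, l) | l <- enum 'I_Nsc].
have uJ : uniq J.
  have ip b : injective (fun l : 'I_Nsc => (b, l) : int * 'I_Nsc) by move=> ? ? [].
  rewrite cat_uniq (map_inj_uniq (ip b0)) (map_inj_uniq (ip b1)) !enum_uniq andbT /=.
  apply/hasPn => _ /mapP[l _ ->]; apply/mapP => -[l' _ [e _]].
  by rewrite e eqxx in b01.
have mA i : measurable (A i) by rewrite /A; case: ifP => _; exact: measurable_box.
have PA i : (0 < P ((complex_pair \o Z i) @^-1` A i))%E.
  have M1 : M < M + 1 by rewrite ltrDl.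
  have m1 : -1 < 1 :> R by rewrite (@lt_trans _ _ 0)// oppr_lt0.
  by rewrite /A; case: ifP => _; exact: (complex_normal_box_gt0 v0 _ _ (xN i)).
pose Ev := \bigcap_(i in [set` J]) (complex_pair \o Z i) @^-1` A i.
have mEv : measurable Ev.
  apply: fin_bigcap_measurable => // i _.
  by rewrite -[X in measurable X]setTI; apply: (xN i).1.
have Ev0 : (0 < P Ev)%E by exact: independent_boxes_gt0.
have EvN : Ev `<=` N.
  move=> w Ew; apply: subN => /= Heq.
  have small b l : (b, l) \in J -> (b, l) != (b0, l0) -> `|x b l w| <= 2.
    move=> /(Ew (b, l)); rewrite /A => + /negbTE bl; rewrite bl /= /box /=.
    rewrite !in_itv/= -!ltr_norml => -[h1 h2].
    apply: le_trans (norm_complex_le _) _.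
    have -> : 2 = (1 + 1)%:C :> R[i] by rewrite rmorphD rmorph1.
    by rewrite lecR lerD// ltW.
  have in0 l : (b0, l) \in J by rewrite mem_cat map_f ?mem_enum.
  have in1 l : (b1, l) \in J by rewrite mem_cat (map_f (pair b1)) ?mem_enum ?orbT.
  have big : M%:C < `|x b0 l0 w|.
    have := Ew (b0, l0) (in0 l0); rewrite /A eqxx /= /box /= !in_itv/= =>
        -[/andP[h1 _] _].
    apply: lt_le_trans (normc_ge_Re _); rewrite ltcR.
    exact: lt_le_trans h1 (ler_norm _).
  suff le_M : `|x b0 l0 w| <= M%:C by have := lt_le_trans big le_M; rewrite ltxx.
  have -> : x b0 l0 w = (\sum_l x b1 l w * c1 l - \sum_(l | l != l0) x b0 l w *
      c0 l) / c0 l0.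
    rewrite -Heq (bigD1 l0)//= addrK mulfK//.
    by rewrite -normr_eq0 n0 oner_eq0.
  rewrite normrM normfV n0 invr1 mulr1.
  apply: le_trans (ler_normB _ _) _.
  have bsum (Q : pred 'I_Nsc) b (c : 'I_Nsc -> R[i]) : (forall l, `|c l| = 1) ->
      (forall l, Q l -> `|x b l w| <= 2) -> `|\sum_(l | Q l) x b l w * c l| <= (2 *
          Nsc)%:R.
    move=> c1' xb; apply: le_trans (ler_norm_sum _ _ _) _.
    apply: (@le_trans _ _ (\sum_(l < Nsc) 2)); last first.
      by rewrite sumr_const card_ord mulrnA.
    rewrite [leRHS](bigID Q)/= -[leLHS]addr0; apply: lerD.
      by apply: ler_sum => l Ql; rewrite normrM c1' mulr1 xb.
    by apply: sumr_ge0.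
  have -> : M%:C = (2 * Nsc)%:R + (2 * Nsc)%:R :> R[i].
    by rewrite rmorph_nat -natrD addnn -mul2n mulnA.
  apply: lerD; apply: bsum => // l Ql; apply: small => //.
    by rewrite xpair_eqE eq_sym (negbTE b01).
  by rewrite xpair_eqE eqxx.
have : (P Ev <= P N)%E by apply: le_measure; rewrite ?inE.
by rewrite PN0 leNgt Ev0.
Qed.

End SymbolSeparation.

(** The word [only] becomes the third clause: outside the flat range the flat limit is not almost
    sure. Its guard [beta2 Ncp E k != alpha ^+ 2] matters: at k = L - 1 - Ncp all taps already reach
    the current block, and elsewhere the missing taps may have variance 0; in both cases the two-tap
    limit is itself flat. Positive power is required since symbols of variance 0 make both limits 0
    almost surely. *)
Theorem lemma1
  (R : realType) (d : measure_display) (Omega : measurableType d)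
  (P : probability Omega R)
  (Nfft Nsc Ncp L : nat)
  (Nsc_gt0 : (0 < Nsc)%N) (Nsc_le : (Nsc <= Nfft)%N)
  (L_gt0 : (0 < L)%N) (L_le : (L <= Nfft)%N)
  (E : 'I_L -> R) (E_ge0 : forall p, 0 <= E p) (alpha_gt0 : 0 < alphaL E)
  (Pow sigma2 : R) (Pow_ge0 : 0 <= Pow) (sigma2_ge0 : 0 <= sigma2)
  (h : 'I_L -> nat -> Omega -> R[i])
  (x : int -> 'I_Nsc -> Omega -> R[i])
  (z : int -> Omega -> R[i])
  (h_normal : forall p a, complex_normal P (E p) (h p a))
  (h_indep : mutually_independent P (fun pa : 'I_L * nat => h pa.1 pa.2))
  (x_iid : iid_complex_normal P Pow (fun bl : int * 'I_Nsc => x bl.1 bl.2))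
  (z_iid : iid_complex_normal P sigma2 z) :
  let H (omega : Omega) p a := h p a omega in
  let X (omega : Omega) b l := x b l omega in
  let Z (omega : Omega) k := z k omega in
  let s (omega : Omega) k := ofdm Nfft Ncp (X omega) k in
  let r (omega : Omega) Nt k :=
    received Nfft Ncp (H omega) (X omega) (Z omega)
      (mrt_precoder Nfft (H omega) Nt) k in
  let alpha := alphaL E in
  [/\ forall k : int, - Ncp%:Z <= k <= Nfft%:Z - 1 ->
        {ae P, forall omega,
          r omega Nt k / sqrtC Nt%:R @[Nt --> \oo] -->
            ((beta2 Ncp E k / alpha)%:C * s omega k
             + ((alpha ^+ 2 - beta2 Ncp E k) / alpha)%:C
               * s omega (k - Nfft%:Z) : R[i]^o)},
      forall k : int, L%:Z - Ncp%:Z <= k <= Nfft%:Z - 1 ->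
        {ae P, forall omega,
          r omega Nt k / sqrtC Nt%:R @[Nt --> \oo] -->
            (alpha%:C * s omega k : R[i]^o)}
    & 0 < Pow ->
      forall k : int, - Ncp%:Z <= k < L%:Z - Ncp%:Z ->
        beta2 Ncp E k != alpha ^+ 2 ->
        ~ {ae P, forall omega,
            r omega Nt k / sqrtC Nt%:R @[Nt --> \oo] -->
              (alpha%:C * s omega k : R[i]^o)}].
Proof.
move=> H X Z s r alpha.
have Nfft_gt0 : (0 < Nfft)%N by exact: leq_trans Nsc_le.
have taps : {ae P, forall w, forall p q : 'I_L,
    (\sum_(a < n) h p a w * Num.conj (h q a w)) / n%:R @[n --> \oo] -->
      ((if p == q then E p else 0)%:C : R[i]^o)}.
  by do 2 (apply: filter_forall => ?); exact: tap_correlation.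
have two_tap k : - Ncp%:Z <= k <= Nfft%:Z - 1 ->
    {ae P, forall omega, r omega Nt k / sqrtC Nt%:R @[Nt --> \oo] -->
      ((beta2 Ncp E k / alpha)%:C * s omega k
        + ((alpha ^+ 2 - beta2 Ncp E k) / alpha)%:C * s omega (k - Nfft%:Z) : R[i]^o)}.
  move=> kb; apply: filterS taps => w Hw.
  exact: (@cvg_received R Nfft Nsc Ncp L Nfft_gt0 L_le E (H w) E_ge0 alpha_gt0 Hw (X w)
      (Z w) k kb).
have alpha_n0 : alpha != 0 by rewrite gt_eqF.
split=> //.
- move=> k /andP[k1 k2].
  have bE : beta2 Ncp E k = alpha ^+ 2.
    rewrite alphaL_sqr//; apply: eq_bigl => m; have := ltn_ord m; lia.
  have kb : - Ncp%:Z <= k <= Nfft%:Z - 1 by lia.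
  apply: filterS (two_tap k kb) => w.
  by rewrite bE subrr mul0r mul0r addr0 expr2 mulfK.
move=> Pow_gt0 k /andP[k1 k2] bn flat.
have kb : in_block Nfft Ncp k by rewrite /in_block; lia.
(* From k < L - Ncp and L <= Nfft, the sample k - Nfft is local index k + Ncp of block -1. *)
have kb2 : in_block Nfft Ncp (k + Ncp%:Z) by rewrite /in_block; lia.
have s0 w : s w k = ofdm_block Nfft Ncp (X w) 0 k.
  by rewrite -ofdmE// mul0r add0r.
have s1 w : s w (k - Nfft%:Z) = ofdm_block Nfft Ncp (X w) (-1) (k + Ncp%:Z).
  by rewrite -ofdmE//; congr (ofdm _ _ _ _); lia.
have tw1 (a : int) : `|@twiddle R Nfft a| = 1.
  by apply/eqP; rewrite -(@sqrp_eq1 _ `|_|)// normCK twiddle_norm.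
apply: (@symbols_separated _ _ _ P Nsc Pow x (fun l => twiddle Nfft (l%:Z * k))
  (fun l => twiddle Nfft (l%:Z * (k + Ncp%:Z))) 0 (-1) Nsc_gt0 Pow_gt0) => //.
move: flat (two_tap k kb); apply: filterS2 => w c1 c2.
set b := beta2 Ncp E k in c2 *.
have e : alpha%:C * s w k = (b / alpha)%:C * s w k
    + ((alpha ^+ 2 - b) / alpha)%:C * s w (k - Nfft%:Z) :> R[i].
  exact: (@cvg_unique R[i]^o (@norm_hausdorff _ _) _ _ _ _ c1 c2).
move/eqP: e; rewrite -subr_eq0.
(* By uniqueness of limits the flat and two-tap expressions agree; their difference factors through
   alpha^2 - beta_k^2, which is nonzero, so the samples at k and k - Nfft must coincide. *)
have -> : alpha%:C * s w k - ((b / alpha)%:C * s w k + ((alpha ^+ 2 - b) / alpha)%:C *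
    s w (k - Nfft%:Z)) =
    ((alpha ^+ 2 - b) / alpha)%:C * (s w k - s w (k - Nfft%:Z)).
  have -> : alpha%:C = (b / alpha)%:C + ((alpha ^+ 2 - b) / alpha)%:C :> R[i].
    by rewrite -rmorphD /=; congr (_%:C); field.
  ring.
rewrite mulf_eq0 fmorph_eq0 mulf_eq0 invr_eq0 (negbTE alpha_n0) orbF subr_eq0 eq_sym
    (negbTE bn) /=.
rewrite subr_eq0 s0 s1 /ofdm_block kb kb2 => /eqP e; apply: mulfI e.
by rewrite invr_eq0 sqrtC_eq0 pnatr_eq0 -lt0n.
Qed.
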